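(* Let $\mathfrak{g}$ be a filiform Lie algebra of dimension $12$ over a field $k$ of characteristic zero with law $\lambda\in\mathcal{A}_{12}$. Then: (1) if $\lambda\in\mathcal{A}_{12}^1$, there is a $2$-cocycle $\omega\in Z^2(\mathfrak{g},k)$ such that $H^2(\mathfrak{g},k)=\mathrm{span}\{[\omega_1],[\omega_2],[\omega]\}$, and $\mathfrak{g}$ is not symplectic; (2) if $\lambda\in\mathcal{A}_{12}^2$, there is a $2$-cocycle $\beta\in Z^2(\mathfrak{g},k)$ with $\det(\beta)\neq 0$ such that $H^2(\mathfrak{g},k)=\mathrm{span}\{[\omega_1],[\omega_2],[\beta]\}$; in particular $\mathfrak{g}$ is symplectic; (3) if $\lambda\in\mathcal{A}_{12}^3$, then $H^2(\mathfrak{g},k)=\mathrm{span}\{[\omega_1],[\omega_2]\}$, and $\mathfrak{g}$ is not symplectic.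
   Context: For a Lie algebra $\mathfrak{g}$ put $\mathfrak{g}^0=\mathfrak{g}$, $\mathfrak{g}^j=[\mathfrak{g}^{j-1},\mathfrak{g}]$. A nilpotent Lie algebra of dimension $n$ is filiform if $\mathfrak{g}^{n-1}=0$ and $\mathfrak{g}^{n-2}\neq 0$. $H^2(\mathfrak{g},k)=Z^2(\mathfrak{g},k)/B^2(\mathfrak{g},k)$ is cohomology with trivial coefficients: $Z^2$ consists of the $\omega\in\mathrm{Hom}(\Lambda^2\mathfrak{g},k)$ with $\omega([x,y]\wedge z)-\omega([x,z]\wedge y)+\omega([y,z]\wedge x)=0$, and $B^2$ of those of the form $\omega(x\wedge y)=f([x,y])$, $f\in\mathrm{Hom}(\mathfrak{g},k)$. $\mathfrak{g}$ is symplectic if some $\omega\in Z^2(\mathfrak{g},k)$ is nondegenerate; $\det(\beta)$ is the determinant of the matrix of $\beta$ in the given basis. Laws: for even $n$ let $\mathcal{I}_n=\{(k,s): 2\le k\le n/2,\ 2k+1\le s\le n\}\cup\{(n/2,n)\}$. Every filiform Lie algebra of dimension $n$ has an adapted basis $(e_1,\dots,e_n)$, i.e. one in which the brackets are $[e_1,e_i]=e_{i+1}$ for $2\le i\le n-1$, $[e_1,e_n]=0$, and $$[e_i,e_j]=\sum_{r=1}^{n}\Bigl(\sum_{\ell=0}^{\lfloor (j-i-1)/2\rfloor}(-1)^\ell\binom{j-i-\ell-1}{\ell}\alpha_{i+\ell,\,r-j+i+2\ell+1}\Bigr)e_r,\qquad 2\le i<j\le n,$$ with constants $\alpha_{k,s}\in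 k$ that vanish for $(k,s)\notin\mathcal{I}_n$. $\mathcal{A}_n$ is the set of such laws (families $(\alpha_{k,s})$ for which the Jacobi identity holds). In an adapted basis, $\omega_\ell\in\mathrm{Hom}(\Lambda^2\mathfrak{g},k)$ is defined by $\omega_\ell(e_j\wedge e_{2\ell+3-j})=(-1)^j$ for $2\le j\le\lfloor(2\ell+3)/2\rfloor$, all values not determined by this and skew-symmetry being zero; so $\omega_1(e_2\wedge e_3)=1$, and $\omega_2(e_2\wedge e_5)=1$, $\omega_2(e_3\wedge e_4)=-1$. ($\omega_1,\omega_2$ are $2$-cocycles.) Consider, for an even-dimensional filiform $\mathfrak{g}$ of dimension $n$, the properties: (a) $\mathfrak{g}$ contains no one-codimensional subspace $U\supseteq\mathfrak{g}^1$ with $[U,\mathfrak{g}^1]\subseteq\mathfrak{g}^4$; (b) $\mathfrak{g}^{(n-4)/2}$ is abelian; (c) $[\mathfrak{g}^1,\mathfrak{g}^1]\subseteq\mathfrak{g}^6$. In terms of a law these are equivalent to $\alpha_{2,5}\neq0$, $\alpha_{n/2,n}=0$, $\alpha_{3,7}=0$ respectively. $\mathcal{A}_n^1$ is the set of laws in $\mathcal{A}_n$ satisfying (a),(b),(c); $\mathcal{A}_n^2$ those satisfying (a),(b) but not (c); $\mathcal{A}_n^3$ those satisfying (a) but not (b). *)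

(* Defs.v *)
From HB Require Import structures.
From mathcomp Require Import all_boot all_order all_algebra.
From mathcomp Require Import boolp classical_sets.

Set Implicit Arguments.
Unset Strict Implicit.
Unset Printing Implicit Defensive.

Import GRing.Theory.
Local Open Scope ring_scope.
Local Open Scope classical_set_scope.

(* Bilinear maps as elements of 'Hom(V, 'Hom(V, W)). bilin e F is the bilinear
   map sending (e_i, e_j) to F i j (see bilinE). *)
Section Bilinear.
Variables (k : fieldType) (V W : vectType k) (n : nat).
Variables (e : n.-tuple V) (F : 'I_n -> 'I_n -> W).

Definition bilin_fun (x y : V) : W :=
  \sum_i \sum_j (coord e i x * coord e j y) *: F i j.

Fact bilin_fun_linearr x : linear (bilin_fun x).
Proof.
move=> a y y'; rewrite /bilin_fun scaler_sumr -big_split; apply: eq_bigr => i _.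
rewrite /= scaler_sumr -big_split; apply: eq_bigr => j _ /=.
by rewrite linearP scalerA -scalerDl; congr (_ *: _); rewrite mulrDr mulrCA.
Qed.
HB.instance Definition _ x :=
  GRing.isLinear.Build k V W _ (bilin_fun x) (bilin_fun_linearr x).

Definition bilinl (x : V) : 'Hom(V, W) := linfun (bilin_fun x).

Fact bilinl_linear : linear bilinl.
Proof.
move=> a x x'; apply/lfunP => y; rewrite add_lfunE scale_lfunE !lfunE /=.
rewrite /bilin_fun.
rewrite scaler_sumr -big_split; apply: eq_bigr => i _.
rewrite /= scaler_sumr -big_split; apply: eq_bigr => j _ /=.
by rewrite linearP scalerA -scalerDl; congr (_ *: _); rewrite mulrDl mulrA.
Qed.
HB.instance Definition _ :=
  GRing.isLinear.Build k V 'Hom(V, W) _ bilinl bilinl_linear.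

Definition bilin : 'Hom(V, 'Hom(V, W)) := linfun bilinl.

Lemma bilinE (i j : 'I_n) : free e -> bilin e`_i e`_j = F i j.
Proof.
move=> fe; rewrite !lfunE /= /bilin_fun (bigD1 i) //= (bigD1 j) //=.
rewrite !coord_free // !eqxx mulr1 scale1r.
rewrite [X in _ + X + _]big1 ?addr0 => [|j' nj]; last first.
  by rewrite !coord_free // (eq_sym j) (negPf nj) mulr0 scale0r.
rewrite big1 ?addr0 // => i' ni; apply: big1 => j' _.
by rewrite !coord_free // (eq_sym i) (negPf ni) mul0r scale0r.
Qed.

End Bilinear.

Section LieAlgebra.
Variables (k : fieldType) (g : vectType k).
Implicit Types (br : 'Hom(g, 'Hom(g, g))) (U V : {vspace g}).

Definition lie_bracket br : Prop :=
  (forall x, br x x = 0) /\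
  (forall x y z, br (br x y) z + br (br y z) x + br (br z x) y = 0).

(* The span of all [u, v] with u in U and v in V, as for the product prodv of
   subspaces of an algebra. *)
Definition brv br U V : {vspace g} :=
  <<[seq br u v | u <- vbasis U, v <- vbasis V]>>%VS.

Lemma brv_subP br U V (X : {vspace g}) :
  reflect {in U & V, forall u v, br u v \in X} (brv br U V <= X)%VS.
Proof.
apply: (iffP span_subvP) => [sX u v Uu Vv | sX _ /allpairsP[[u v] /= [Uu Vv ->]]].
  rewrite (coord_vbasis Uu) linear_sum sum_lfunE memv_suml // => i _.
  rewrite linearZ /= scale_lfunE rpredZ // (coord_vbasis Vv) linear_sum.
  rewrite memv_suml // => j _; rewrite linearZ rpredZ //; apply/sX/allpairsP.
  by exists ((vbasis U)`_i, (vbasis V)`_j); rewrite !mem_nth ?size_tuple.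
by apply: sX; apply: vbasis_mem.
Qed.

Fixpoint lcs br (j : nat) : {vspace g} :=
  if j is j'.+1 then brv br (lcs br j') fullv else fullv.

Definition filiform br (n : nat) : Prop :=
  [/\ lie_bracket br, \dim {:g} = n, lcs br n.-1 = 0%VS & lcs br n.-2 != 0%VS].

(* Hom(Lambda^2 g, k) is the set of alternating forms in this space. *)
Definition form := 'Hom(g, 'Hom(g, k^o)).

Definition alternating (w : form) : Prop := forall x, w x x = 0.

Definition Z2 br : set form :=
  [set w : form | alternating w /\
    forall x y z, w (br x y) z - w (br x z) y + w (br y z) x = 0].

Definition B2 br : set form :=
  [set w : form | exists f : 'Hom(g, k^o), forall x y, w x y = f (br x y)].

(* The coset w + B2. *)
Definition cls br (w : form) : set form := [set w' | B2 br (w' - w)].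

Definition H2 br : set (set form) := [set cls br w | w in Z2 br].

(* The span of the classes of the members of s: linear combinations of cosets
   are the cosets of the linear combinations of representatives. *)
Definition cls_span br (s : seq form) : set (set form) :=
  [set cls br w | w in [set w : form | w \in <<s>>%VS]].

Definition nondegenerate (w : form) : Prop :=
  forall x, (forall y, w x y = 0) -> x = 0.

Definition symplectic br : Prop := exists2 w, Z2 br w & nondegenerate w.

Definition gram n (e : n.-tuple g) (w : form) : 'M[k]_n :=
  \matrix_(i, j) w e`_i e`_j.

Definition propA br : Prop :=
  ~ exists U : {vspace g},
      [/\ (\dim U).+1 = \dim {:g}, (lcs br 1 <= U)%VS
        & (brv br U (lcs br 1) <= lcs br 4)%VS].

Definition propB br : Prop :=
  let h := lcs br ((\dim {:g} - 4) %/ 2) in brv br h h = 0%VS.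

Definition propC br : Prop := (brv br (lcs br 1) (lcs br 1) <= lcs br 6)%VS.

End LieAlgebra.

(* Indices of basis vectors are 1-based in the formulas below, whereas tuples
   and 'I_n are 0-based: e_(i + 1) is e`_i. *)
Section Laws.
Variables (k : fieldType) (n : nat).
Implicit Types alpha : nat -> nat -> k.

Definition in_I (a s : nat) : bool :=
  [&& 2 <= a, a <= n %/ 2, 2 * a + 1 <= s & s <= n]%N
  || ((a == n %/ 2) && (s == n))%N.

(* The coefficient of e_r in [e_i, e_j], for 1 <= i < j <= n. When
   r + i + 2 l + 1 < j the truncated subtraction yields the second index 0,
   at which alpha vanishes, as it does at the intended negative index. *)
Definition law_coef alpha (i j r : nat) : k :=
  if i == 1%N then ((2 <= j)%N && (r == j.+1))%:R
  else \sum_(0 <= l < ((j - i - 1) %/ 2).+1)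
         (-1) ^+ l * 'C(j - i - l - 1, l)%:R * alpha (i + l)%N (r + i + 2 * l + 1 - j)%N.

(* The right-hand side of the bracket formula in a space with basis e. *)
Definition law_value (g : vectType k) (e : n.-tuple g) alpha (i j : 'I_n) : g :=
  \sum_(r < n) law_coef alpha i.+1 j.+1 r.+1 *: e`_r.

Definition adapted_basis (g : vectType k) (br : 'Hom(g, 'Hom(g, g)))
    (e : n.-tuple g) alpha : Prop :=
  basis_of fullv e /\
  forall i j : 'I_n, (i < j)%N -> br e`_i e`_j = law_value e alpha i j.

Definition std_basis : n.-tuple 'rV[k]_n := [tuple delta_mx 0 i | i < n].

(* The alternating bracket on k^n with law alpha; it satisfies the Jacobi
   identity only if alpha does. *)
Definition law_bracket alpha : 'Hom('rV[k]_n, 'Hom('rV[k]_n, 'rV[k]_n)) :=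
  bilin std_basis (fun i j : 'I_n =>
    if (i < j)%N then law_value std_basis alpha i j
    else if (j < i)%N then - law_value std_basis alpha j i
    else 0).

Definition laws : set (nat -> nat -> k) :=
  [set alpha | (forall a s, ~~ in_I a s -> alpha a s = 0) /\
               lie_bracket (law_bracket alpha)].

Definition laws1 : set (nat -> nat -> k) :=
  [set alpha | let br := law_bracket alpha in
     [/\ laws alpha, propA br, propB br & propC br]].

Definition laws2 : set (nat -> nat -> k) :=
  [set alpha | let br := law_bracket alpha in
     [/\ laws alpha, propA br, propB br & ~ propC br]].

Definition laws3 : set (nat -> nat -> k) :=
  [set alpha | let br := law_bracket alpha in
     [/\ laws alpha, propA br & ~ propB br]].

(* The values of omega_l on (e_i, e_j): the second case is the first one
   transposed and negated. *)
Definition omega_coef (l i j : nat) : k :=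
  if [&& 2 <= i, i <= (2 * l + 3) %/ 2 & i + j == 2 * l + 3]%N then (-1) ^+ i
  else if [&& 2 <= j, j <= (2 * l + 3) %/ 2 & i + j == 2 * l + 3]%N
       then - (-1) ^+ j
  else 0.

Definition omega (g : vectType k) (e : n.-tuple g) (l : nat) : form g :=
  bilin e (fun i j : 'I_n => omega_coef l i.+1 j.+1 : k^o).

End Laws.

(* Main.v *)
(* Modulo coboundaries a cocycle w satisfies w(e_1, e_j) = 0 for j < 12. Closedness
   on (e_1, e_i, e_j) then determines w from c = w(e_1, e_12) and the numbers
   b_i = w(e_i, e_(i+1)), of which only b_2, ..., b_6 can be nonzero, and the triples
   of basis vectors other than e_1 give linear equations in c, b_2, ..., b_6 with
   coefficients polynomial in the law. The parameters b_2 and b_3 are free: they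
   correspond to omega_1 and - omega_2.

   Put (t, x, y, z) = (alpha_(2,5), alpha_(3,7), alpha_(4,9), alpha_(5,11)). If
   alpha_(6,12) = 0, the Jacobi identity leaves only the possibilities
   (t, 0, 0, 0) and z (420, 42, 6, 1); in both of them c is free and determines
   b_4, b_5, b_6. In the first one b_6 = 0, and the e_i with i >= 10 pair
   nontrivially with e_1 and e_2 only, so every cocycle is degenerate; in the
   second one b_6 = 2 z c / 11 and, for c = 1 and b_2 = b_3 = 0, the Gram matrix is
   antitriangular with a nonzero antidiagonal. If alpha_(6,12) <> 0, then c = 0 and
   b_4 = b_5 = b_6 = 0, so that e_12 lies in the radical of every cocycle. *)
Require Import Defs.
From mathcomp Require Import all_boot all_order all_algebra.
From mathcomp Require Import boolp classical_sets.
From mathcomp Require Import perm zify ring.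

Set Implicit Arguments.
Unset Strict Implicit.
Unset Printing Implicit Defensive.

Import GRing.Theory.
Local Open Scope ring_scope.

(** * Symbolic polynomials in the law and the cocycle parameters *)

(* Integer polynomials with indeterminates indexed by pairs: (a, s) with a >= 2 stands
   for alpha_(a,s), (0, 0) for c and (0, i) for b_i. They are lists of monomials, so
   that the Jacobi and cocycle equations can be computed. *)
Definition fpoly := seq (int * seq (nat * nat)).

Definition fmul (p q : fpoly) : fpoly :=
  [seq (x.1 * y.1, x.2 ++ y.2) | x <- p, y <- q].

Definition fopp (p : fpoly) : fpoly := [seq (- x.1, x.2) | x <- p].

(** Drops the monomials containing an indeterminate known to vanish. Like terms are never collected,
    so an empty result is a sufficient test for vanishing, decided by computation. *)
Definition frestr (keep : pred (nat * nat)) (p : fpoly) : fpoly :=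
  [seq x <- p | all keep x.2].

Section Feval.
Variables (k : fieldType) (rho : nat -> nat -> k).

Definition feval (p : fpoly) : k :=
  \sum_(x <- p) (\prod_(v <- x.2) rho v.1 v.2) *~ x.1.

Lemma feval_cat p q : feval (p ++ q) = feval p + feval q.
Proof. exact: big_cat. Qed.

Lemma feval_flatten ps : feval (flatten ps) = \sum_(p <- ps) feval p.
Proof. by rewrite /feval big_flatten. Qed.

Lemma fevalN p : feval (fopp p) = - feval p.
Proof.
by rewrite /feval /fopp big_map -sumrN; apply: eq_bigr => x _; rewrite /= mulrNz.
Qed.

Lemma fevalM p q : feval (fmul p q) = feval p * feval q.
Proof.
rewrite /feval /fmul big_allpairs_dep /= mulr_suml; apply: eq_bigr => x _.
rewrite mulr_sumr; apply: eq_bigr => y _ /=.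
by rewrite big_cat /= mulrzAl mulrzAr -mulrzA [y.1 * _]mulrC.
Qed.

Lemma feval_var a s : feval [:: (1, [:: (a, s)])] = rho a s.
Proof. by rewrite /feval !big_seq1. Qed.

Lemma feval_restr keep p :
  (forall a s, ~~ keep (a, s) -> rho a s = 0) -> feval (frestr keep p) = feval p.
Proof.
move=> rho0; rewrite /feval big_filter [RHS](bigID (fun x => all keep x.2)) /=.
rewrite [X in _ = _ + X]big1 ?addr0 // => x /allPn[[a s] xas nkeep].
by rewrite (big_rem _ xas) /= rho0 // !mul0r mul0rz.
Qed.

End Feval.

(* The coefficient of e_r in [e_i, e_j], for i, j >= 2. *)
Definition brcoef (i j r : nat) : fpoly :=
  let up i j := [seq ((-1) ^+ l * 'C(j - i - l - 1, l)%:Z,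
                      [:: ((i + l)%N, (r + i + 2 * l + 1 - j)%N)])
                | l <- iota 0 ((j - i - 1) %/ 2).+1
                & in_I 12 (i + l) (r + i + 2 * l + 1 - j)] in
  if (i < j)%N then up i j else if (j < i)%N then fopp (up j i) else [::].

(* The coefficient of e_s in the Jacobi sum of e_i, e_j, e_l, for i, j, l >= 2. *)
Definition jacpoly (i j l s : nat) : fpoly :=
  flatten [seq fmul (brcoef i j r) (brcoef r l s) ++ fmul (brcoef j l r) (brcoef r i s)
               ++ fmul (brcoef l i r) (brcoef r j s) | r <- iota 2 11].

(* The value of a normalized cocycle on (e_i, e_(i+d)), for i >= 2: by closedness on
   (e_1, e_i, e_(j-1)), w(e_i, e_j) = c [e_i, e_(j-1)]_12 - w(e_(i+1), e_(j-1)).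
   The b_i with i > 6 vanish. *)
Fixpoint entry_gap (i d : nat) : fpoly :=
  match d with
  | 0 => [::]
  | 1 => if (i <= 6)%N then [:: (1%R, [:: (0, i)])] else [::]
  | d'.+2 => fmul [:: (1%R, [:: (0, 0)])] (brcoef i (i + d'.+1) 12)
             ++ fopp (entry_gap i.+1 d')
  end%N.

Definition entry (i j : nat) : fpoly :=
  if (i <= j)%N then entry_gap i (j - i) else fopp (entry_gap j (i - j)).

Definition cocpoly (i j l : nat) : fpoly :=
  flatten [seq fmul (brcoef i j r) (entry r l) ++ fopp (fmul (brcoef i l r) (entry r j))
               ++ fmul (brcoef j l r) (entry r i) | r <- iota 2 11].

Definition triples : seq (nat * nat * nat) :=
  [seq t <- [seq (p, l) | p <- [seq (i, j) | i <- iota 2 11, j <- iota 2 11],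
                          l <- iota 2 11] | (t.1.1 < t.1.2 < t.2)%N].

Definition no_a6 : pred (nat * nat) := fun v => ~~ ((v.1 == 6) && (v.2 == 12))%N.

(** Certificate for an equation: given cofactors of two known relations, a ring identity is left to
    check. *)
Lemma eq_combination (R : comPzRingType) (a b c1 c2 l1 l2 r1 r2 : R) :
  l1 = r1 -> l2 = r2 -> a - b = c1 * (l1 - r1) + c2 * (l2 - r2) -> a = b.
Proof. by move=> -> ->; rewrite !subrr !mulr0 addr0 => /subr0_eq. Qed.

(** * Relations among alpha_(2,5), alpha_(3,7), alpha_(4,9), alpha_(5,11) *)

Section WeightZero.
Variable k : fieldType.
Hypothesis char0 : [pchar k] =i pred0.
Variables t x y z : k.
Hypothesis t_neq0 : t != 0.
Hypothesis jac1 : 3 * x ^+ 2 = y * (2 * t + x).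
Hypothesis jac2 : 2 * t * z = 4 * x * y + x * z - 6 * y ^+ 2 + y * z.

Lemma numeral_neq0 n : (0 < n)%N -> n%:R != 0 :> k.
Proof.
by move=> n0; rewrite natf_neq0_pchar; apply/pnatP => // p p_prime _; rewrite inE /= char0.
Qed.

(** If 2 t + x = 0, then [jac1] forces x = 0, hence t = 0. Up to sign, this is the coefficient of
    b_4 in [cocycle_234]. *)
Lemma sum2tx_neq0 : 2 * t + x != 0.
Proof.
apply: contraNneq t_neq0 => tx0; have x0 : x = 0.
  apply/eqP; have /eqP := jac1; rewrite tx0 mulr0 mulf_eq0 expf_eq0 /=.
  by rewrite (negPf (numeral_neq0 _)).
by move/eqP: tx0; rewrite x0 addr0 mulf_eq0 (negPf (numeral_neq0 _)).
Qed.

(* The relations are homogeneous; eliminating y, then z, leaves x^4 (t - 10 x) = 0. *)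
Lemma weight_zero_cases : 3 * x * z + 3 * y * z = 4 * y ^+ 2 ->
  [/\ x = 0, y = 0 & z = 0] \/ [/\ z != 0, t = 420 * z, x = 42 * z & y = 6 * z].
Proof.
move=> jac3; have D0 := sum2tx_neq0; have [x0|x_neq0] := eqVneq x 0.
  left; have y0 : y = 0.
    apply/eqP; have /eqP := jac1; rewrite x0 expr0n mulr0 eq_sym mulf_eq0.
    by move: D0; rewrite x0 => /negPf ->; rewrite orbF.
  split=> //; apply/eqP; have /eqP := jac2; rewrite x0 y0 !(mulr0, mul0r, expr0n, subr0, addr0).
  by rewrite !mulf_eq0 (negPf t_neq0) (negPf (numeral_neq0 _)).
right; pose D := 2 * t + x.
(* Multiply [jac3] by [D ^+ 2], substitute y D = 3 x^2 and cancel 6 x. *)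
have h2 : z * (t + 2 * x) * D = 6 * x ^+ 3.
  apply: (mulfI (mulf_neq0 (@numeral_neq0 6 isT) x_neq0)).
  apply: (eq_combination (c1 := D ^+ 2) jac3
    (c2 := 3 * z * D - 4 * (3 * x ^+ 2 + y * D)) jac1); rewrite /D; ring.
(* Multiply [jac2] by D^2 (t + 2 x); by [jac1] and [h2] it becomes 6 x^4 (t - 10 x) = 0. *)
have tx : t = 10 * x.
  apply: (mulfI (mulf_neq0 (@numeral_neq0 6 isT) (expf_neq0 4 x_neq0))).
  have h3 : 2 * t * z * D ^+ 2 * (t + 2 * x) =
      (4 * x * y + x * z - 6 * y ^+ 2 + y * z) * D ^+ 2 * (t + 2 * x).
    by rewrite jac2.
  have h4 : (6 * x ^+ 3 - z * (t + 2 * x) * D) = 0 by rewrite h2 subrr.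
  apply: (eq_combination (c1 := 4 * x ^+ 2 - 4 * t ^+ 2) h4
    (c2 := (t + 2 * x) * (z * D + 4 * x * D - 6 * (3 * x ^+ 2 + y * D))) jac1).
  rewrite -[LHS]addr0 -(subrr (2 * t * z * D ^+ 2 * (t + 2 * x))) {2}h3 /D; ring.
have xy : x = 7 * y.
  apply: (mulfI (mulf_neq0 (@numeral_neq0 3 isT) x_neq0)).
  by move: jac1; rewrite tx => jac1'; apply: etrans (etrans jac1' _); ring.
have xz : x = 42 * z.
  apply: (mulfI (mulf_neq0 (@numeral_neq0 6 isT) (expf_neq0 2 x_neq0))).
  by move: h2; rewrite /D tx => h2'; apply: etrans (etrans (esym h2') _); ring.
split=> //.
- by apply: contraNneq x_neq0 => z0; rewrite xz z0 mulr0.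
- by rewrite tx xz; ring.
- by apply: (mulfI (@numeral_neq0 7 isT)); rewrite -xy xz; ring.
Qed.

(** If y = 2 t - x, then [jac1] gives x^2 = t^2, and [jac2] becomes 2 t^2 = 0 or 66 t^2 = 0. The
    hypothesis on z comes from alpha_(6,12) <> 0, and the number is the coefficient of b_5 in
    [cocycle_236]. *)
Lemma b5_coef_neq0 : z = 3 * x - 2 * t -> 2 * t - x - y != 0.
Proof.
move=> zE; apply: contraNneq t_neq0 => D5; have yE : y = 2 * t - x.
  by apply/eqP; rewrite -subr_eq0 -oppr_eq0 -D5; apply/eqP; ring.
have : (x - t) * (x + t) = 0.
  apply: (mulfI (@numeral_neq0 4 isT)).
  by apply: (eq_combination (c1 := 1) jac1 (c2 := 0) (erefl t)); rewrite yE; ring.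
move=> /eqP; rewrite mulf_eq0 subr_eq0 addr_eq0 => xt.
have t2 : t ^+ 2 = 0.
  case/orP: xt => /eqP xt.
    apply: (mulfI (@numeral_neq0 2 isT)).
    by apply: (eq_combination (c1 := 1) jac2 (c2 := 0) (erefl t)); rewrite zE yE xt; ring.
  apply: (mulfI (@numeral_neq0 66 isT)).
  by apply: (eq_combination (c1 := 1) jac2 (c2 := 0) (erefl t)); rewrite zE yE xt; ring.
by move/eqP: t2; rewrite expf_eq0.
Qed.

End WeightZero.

(** * Auxiliary facts on bracket coefficients and alternating maps *)

Lemma brcoef_gt i j r : (i < j)%N -> brcoef j i r = fopp (brcoef i j r).
Proof. by move=> ij; rewrite /brcoef ij ltnNge ltnW. Qed.

Lemma iota2E : iota 2 11 = [seq r.+2 | r <- iota 0 11]. Proof. by []. Qed.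

Lemma brcoefii i r : brcoef i i r = [::].
Proof. by rewrite /brcoef ltnn. Qed.

Local Arguments iota : simpl never.

Section Bilinear.
Variables (k : fieldType) (g : vectType k) (br : 'Hom(g, 'Hom(g, g))).

Lemma alternatingN (W : vectType k) (w : 'Hom(g, 'Hom(g, W))) :
  (forall x, w x x = 0) -> forall x y, w y x = - w x y.
Proof.
move=> alt x y; have := alt (x + y).
rewrite !linearD /= !add_lfunE !alt add0r addr0 => /eqP.
by rewrite addr_eq0 => /eqP.
Qed.

Definition cocycle_defect (w : Defs.form g) x y z : k :=
  w (br x y) z - w (br x z) y + w (br y z) x.

End Bilinear.

(** * Brackets and the Jacobi identity in an adapted basis *)

Section AdaptedBasis.
Variables (k : fieldType) (g : vectType k) (br : 'Hom(g, 'Hom(g, g))).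
Variables (e : 12.-tuple g) (lam : nat -> nat -> k).
Hypothesis br_lie : lie_bracket br.
Hypothesis lam0 : forall a s, ~~ in_I 12 a s -> lam a s = 0.
Hypothesis e_adapted : adapted_basis br e lam.

(* 1-based indexing, with E i = 0 for i > 12; beware that E 0 = E 1. *)
Definition E (i : nat) : g := nth 0 e i.-1.

Lemma e_basis : basis_of fullv e. Proof. by case: e_adapted. Qed.
Lemma e_free : free e. Proof. exact: basis_free e_basis. Qed.

Lemma E_overflow i : (12 < i)%N -> E i = 0.
Proof. by case: i => // i i12; rewrite /E nth_default ?size_tuple. Qed.

Lemma ordE (i : 'I_12) : e`_i = E i.+1. Proof. by []. Qed.

Lemma brC x y : br y x = - br x y.
Proof. by apply: alternatingN; case: br_lie. Qed.

Lemma brxx x : br x x = 0.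
Proof. by case: br_lie. Qed.

Lemma law_coefE i j r : (2 <= i < j)%N -> law_coef lam i j r = feval lam (brcoef i j r).
Proof.
move=> /andP[i2 ij]; rewrite /law_coef /brcoef ij (_ : i == 1%N = false); last by lia.
rewrite /feval big_map big_filter [RHS]big_mkcond /=.
rewrite /index_iota subn0; apply: eq_bigr => l _.
case: ifP => [_|/negbT/lam0 ->]; last by rewrite mulr0.
by rewrite big_seq1 -mulrzr intrM rmorphXn /= rmorphN1 mulrC.
Qed.

(** For r < i + j every index pair (a, s) in the sum has s < 2 a + 1. The exceptional pair (6, 12)
    occurs only for r = 12 and i + j = 13, which the last hypothesis excludes. *)
Lemma law_coef_low i j r : (2 <= i < j)%N -> (j <= 12)%N -> (r <= 12)%N ->
  (r < i + j)%N -> (r < 12)%N || (13 < i + j)%N -> law_coef lam i j r = 0.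
Proof.
move=> /andP[i2 ij] j12 r12 rij low; rewrite /law_coef (_ : i == 1%N = false); last by lia.
rewrite big_nat big1 // => l /andP[_ ll]; rewrite lam0 ?mulr0 //.
rewrite /in_I; lia.
Qed.

(** Since [E 13] is 0, the case i = 12 is [e_1, e_12] = 0. *)
Lemma br_1E i : (2 <= i <= 12)%N -> br (E 1) (E i) = E i.+1.
Proof.
case: i => [|[|i]] // /andP[_ i12]; have i12' : (i.+1 < 12)%N by lia.
have [_ /(_ ord0 (Ordinal i12') isT)] := e_adapted.
rewrite !ordE /= => ->; rewrite /law_value /law_coef /=.
have [i11|i11] := ltnP i 10; last first.
  rewrite E_overflow ?big1 // => r _.
  by rewrite (_ : r.+1 == i.+3 = false) ?scale0r //; have := ltn_ord r; lia.
have i12'' : (i.+2 < 12)%N by lia.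
rewrite (bigD1 (Ordinal i12'')) //= eqxx scale1r big1 ?addr0 // => r.
by rewrite eqSS -val_eqE /= => /negPf ->; rewrite scale0r.
Qed.

Lemma br_lt i j : (2 <= i < j)%N -> (j <= 12)%N ->
  br (E i) (E j) = \sum_(r <- iota 2 11) law_coef lam i j r *: E r.
Proof.
case: i j => [|i] [|j] //; rewrite ?ltn0 ?andbF // => /andP[i1 ij] j12; have i12 : (i < 12)%N by lia.
have [_ /(_ (Ordinal i12) (Ordinal j12) ij) br_ij] := e_adapted.
rewrite [LHS]br_ij /law_value iota2E big_map.
(* The law sums from r = 1, but the coefficient of e_1 vanishes. *)
rewrite big_ord_recl law_coef_low ?scale0r ?add0r; [|rewrite /=; lia..].
by rewrite -(big_mkord xpredT (fun r => law_coef lam i.+1 j.+1 r.+2 *: E r.+2)).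
Qed.

Lemma br_E i j : (2 <= i <= 12)%N -> (2 <= j <= 12)%N ->
  br (E i) (E j) = \sum_(r <- iota 2 11) feval lam (brcoef i j r) *: E r.
Proof.
move=> i12 j12; have [ij|ji|->] := ltngtP i j.
- by rewrite br_lt; [|lia..]; apply: eq_bigr => r _; rewrite law_coefE //; lia.
- rewrite brC br_lt; [|lia..]; rewrite -sumrN; apply: eq_bigr => r _.
  by rewrite law_coefE; [|lia]; rewrite (brcoef_gt _ ji) fevalN scaleNr.
- by rewrite brxx big1 // => r _; rewrite brcoefii /feval big_nil scale0r.
Qed.

Lemma E_coef_eq0 (c : nat -> k) :
  \sum_(r <- iota 2 11) c r *: E r = 0 -> forall r, (2 <= r <= 12)%N -> c r = 0.
Proof.
move=> c0 r r12; have r11 : (r.-1 < 12)%N by lia.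
pose d i := if i is 0%N then 0 else c i.+1.
have /freeP/(_ (fun i : 'I_12 => d i)) := e_free; rewrite big_ord_recl scale0r add0r.
move: c0; rewrite iota2E big_map -[iota 0 11]/(index_iota 0 11) big_mkord => -> /(_ erefl).
by move=> /(_ (Ordinal r11)); case: r r12 r11 => [|[|r]].
Qed.

Lemma jacobi i j l s : (2 <= i <= 12)%N -> (2 <= j <= 12)%N ->
  (2 <= l <= 12)%N -> (2 <= s <= 12)%N -> feval lam (jacpoly i j l s) = 0.
Proof.
move=> i12 j12 l12; move: s; apply: E_coef_eq0; case: br_lie => _ /(_ (E i) (E j) (E l)).
have step a b c : (2 <= a <= 12)%N -> (2 <= b <= 12)%N -> (2 <= c <= 12)%N ->
  br (br (E a) (E b)) (E c) = \sum_(s <- iota 2 11) 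
     (\sum_(r <- iota 2 11) feval lam (fmul (brcoef a b r) (brcoef r c s))) *: E s.
  move=> a12 b12 c12; rewrite br_E // linear_sum sum_lfunE /=.
  under [RHS]eq_bigr do rewrite scaler_suml.
  rewrite exchange_big /=; apply: eq_big_seq => r; rewrite mem_iota => r12.
  rewrite linearZ /= scale_lfunE br_E; [|lia..].
  by rewrite scaler_sumr; apply: eq_bigr => s _; rewrite fevalM scalerA.
rewrite !step // -!big_split /= => jac0; rewrite -[RHS]jac0; apply: eq_bigr => s _.
rewrite -!scalerDl; congr (_ *: _); rewrite feval_flatten big_map. rewrite -!big_split /=. 
by apply: eq_bigr => r _; rewrite !feval_cat addrA.
Qed.

Lemma brcoef_low i j r : (2 <= i < j)%N -> (j <= 12)%N -> (r <= 12)%N ->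
  (r < i + j)%N -> (r < 12)%N || (13 < i + j)%N -> feval lam (brcoef i j r) = 0.
Proof. by move=> ij *; rewrite -law_coefE // law_coef_low. Qed.

Definition env (c : k) (b : nat -> k) (a s : nat) : k :=
  if a is 0 then (if s is 0 then c else b s) else lam a s.

Lemma feval_env_brcoef c b i j r : (0 < i)%N -> (0 < j)%N ->
  feval (env c b) (brcoef i j r) = feval lam (brcoef i j r).
Proof.
move=> i0 j0; rewrite /brcoef; case: ifP => [_|_]; last case: ifP => [_|_]; last by rewrite /feval !big_nil.
  rewrite /feval !big_map; apply: eq_bigr => l _.
  by rewrite !big_seq1 /=; case: i i0.
rewrite !fevalN; congr (- _).
rewrite /feval !big_map; apply: eq_bigr => l _.
by rewrite !big_seq1 /=; case: j j0.
Qed.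

Lemma feval_cocpoly c b i j l : (0 < i)%N -> (0 < j)%N -> (0 < l)%N ->
  feval (env c b) (cocpoly i j l) = \sum_(r <- iota 2 11)
    (feval lam (brcoef i j r) * feval (env c b) (entry r l)
     - feval lam (brcoef i l r) * feval (env c b) (entry r j)
     + feval lam (brcoef j l r) * feval (env c b) (entry r i)).
Proof.
move=> i0 j0 l0; rewrite feval_flatten big_map; apply: eq_bigr => r _.
by rewrite !feval_cat fevalN !fevalM !feval_env_brcoef // addrA.
Qed.

Lemma form_br_E (v : Defs.form g) i j l : (2 <= i <= 12)%N -> (2 <= j <= 12)%N ->
  v (br (E i) (E j)) (E l) = \sum_(r <- iota 2 11) feval lam (brcoef i j r) * v (E r) (E l).
Proof.
move=> i12 j12; rewrite br_E // linear_sum sum_lfunE /=.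
by apply: eq_bigr => r _; rewrite linearZ /= scale_lfunE.
Qed.

(** * Values of a normalized cocycle *)

Section NormalizedCocycle.
Variable v : Defs.form g.
Hypotheses (v_Z2 : Z2 br v).
Hypothesis v1 : forall j, (2 <= j <= 11)%N -> v (E 1) (E j) = 0.

Let vN x y : v y x = - v x y. Proof. by apply: alternatingN; case: v_Z2. Qed.

(** Closedness on (e_1, e_i, e_j): by normalization only the e_12-component of [e_i, e_j] pairs
    nontrivially with e_1. *)
Lemma cocycle1 i j : (2 <= i <= 12)%N -> (2 <= j <= 12)%N ->
  v (E i.+1) (E j) + v (E i) (E j.+1) = feval lam (brcoef i j 12) * v (E 1) (E 12).
Proof.
move=> i12 j12; have [_ /(_ (E 1) (E i) (E j))] := v_Z2.
rewrite !br_1E // [v (E j.+1) _]vN opprK => /eqP; rewrite addr_eq0 => /eqP ->.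
rewrite form_br_E // (bigD1_seq 12%N) ?iota_uniq //= big1_seq ?addr0.
  by rewrite vN mulrN opprK.
by move=> r /andP[r12]; rewrite mem_iota => r11; rewrite vN v1 ?oppr0 ?mulr0 //; lia.
Qed.

(** For i + j >= 15, [cocycle1] gives v(e_i, e_j) = - v(e_(i-1), e_(j+1)); moving along the
    antidiagonal ends at e_13 = 0. In particular b_i = 0 for i >= 7. *)
Lemma cocycle_high i j : (2 <= i < j)%N -> (15 <= i + j)%N -> v (E i) (E j) = 0.
Proof.
move=> ij; have [j12|j12] := leqP j 12; last by rewrite (E_overflow j12) linear0.
elim: {j}(12 - j)%N {-2}j (erefl (12 - j)%N) i ij j12 => [|n IH] j jn i ij j12 sum15.
  have -> : j = 12 by lia.
  have -> : i = i.-1.+1 by lia.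
  have := @cocycle1 i.-1 12; rewrite (E_overflow (ltnSn 12)) linear0 addr0 => -> //; [|lia].
  by rewrite brcoef_low ?mul0r //; lia.
have := @cocycle1 i.-1 j; rewrite (IH j.+1) ?prednK; [|lia..].
by rewrite addr0 => ->; [|lia..]; rewrite brcoef_low ?mul0r //; lia.
Qed.

Let env_v := env (v (E 1) (E 12)) (fun i => v (E i) (E i.+1)).

Lemma entry_gapE i d : (2 <= i)%N -> (i + d <= 12)%N ->
  v (E i) (E (i + d)) = feval env_v (entry_gap i d).
Proof.
elim/ltn_ind: d i => -[|[|d]] IH i i2 id12.
- by rewrite addn0 /feval big_nil; case: v_Z2.
- rewrite /=; case: ifP => i6; last by rewrite cocycle_high /feval ?big_nil //; lia.
  by rewrite feval_var addn1; case: i i2 {IH id12 i6}.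
rewrite /= feval_cat fevalN fevalM feval_env_brcoef //; [|lia..].
rewrite -IH; [|lia..]; rewrite feval_var.
apply/eqP; rewrite mulrC -subr_eq opprK; apply/eqP.
rewrite addrC addSnnS !addnS -cocycle1 //; lia.
Qed.

Lemma entryE i j : (2 <= i <= 12)%N -> (2 <= j <= 12)%N ->
  v (E i) (E j) = feval env_v (entry i j).
Proof.
move=> i12 j12; rewrite /entry; case: leqP => ij.
  by rewrite -entry_gapE ?subnKC //; lia.
by rewrite fevalN -entry_gapE ?subnKC //; lia.
Qed.

Lemma cocycle_eq i j l : (2 <= i <= 12)%N -> (2 <= j <= 12)%N -> (2 <= l <= 12)%N ->
  feval env_v (cocpoly i j l) = 0.
Proof.
move=> i12 j12 l12; rewrite feval_cocpoly -?/env_v; [|lia..].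
have [_ /(_ (E i) (E j) (E l)) defect0] := v_Z2; rewrite -[RHS]defect0.
rewrite !form_br_E // -sumrB -big_split /=.
apply: eq_big_seq => r; rewrite mem_iota => r12.
by rewrite !entryE //; lia.
Qed.

End NormalizedCocycle.

(** * Construction of cocycles from values on the basis *)

Lemma basis_ind (P : g -> Prop) :
  (forall a x y, P x -> P y -> P (a *: x + y)) ->
  (forall i, (1 <= i <= 12)%N -> P (E i)) -> forall x, P x.
Proof.
move=> P_lin PE x; have P0 : P 0.
  by rewrite -(subrr (E 1)) addrC -scaleN1r; apply: P_lin; apply: PE.
rewrite (coord_basis e_basis (memvf x)); elim/big_ind: _ => // [y z Py Pz|i _].
  by rewrite -[y]scale1r; apply: P_lin.
by rewrite -[_ *: _]addr0; apply: P_lin => //; apply: (PE i.+1); apply: ltn_ord.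
Qed.

Lemma form_ext (w w' : Defs.form g) :
  (forall i j, (1 <= i <= 12)%N -> (1 <= j <= 12)%N ->
     w (E i) (E j) = w' (E i) (E j)) -> w = w'.
Proof.
move=> ww'; apply/lfunP => x; apply/lfunP => y.
elim/basis_ind: x => [a x x' IH IH'|i i12].
  by rewrite !linearP !add_lfunE !scale_lfunE IH IH'.
elim/basis_ind: y => [a y y' IH IH'|j j12]; last exact: ww'.
by rewrite !linearP /= IH IH'.
Qed.

Lemma bilin_E (W : vectType k) (F : nat -> nat -> W) i j :
  (1 <= i <= 12)%N -> (1 <= j <= 12)%N ->
  bilin e (fun i j : 'I_12 => F i.+1 j.+1) (E i) (E j) = F i j.
Proof.
case: i j => [|i] [|j] // i12 j12.
exact: (bilinE _ (Ordinal i12) (Ordinal j12) e_free).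
Qed.

(** The cocycle defect of an alternating form is trilinear and alternating, so increasing triples of
    basis vectors suffice. *)
Lemma Z2_basis (w : Defs.form g) : alternating w ->
  (forall i j l, (1 <= i < j)%N -> (j < l <= 12)%N ->
     cocycle_defect br w (E i) (E j) (E l) = 0) -> Z2 br w.
Proof.
move=> alt w0; have wN := alternatingN alt; split=> //.
pose D := cocycle_defect br w; rewrite -/(cocycle_defect br w) -/D in w0 *.
have D12 x y z : D y x z = - D x y z.
  rewrite /D /cocycle_defect (brC x y) linearN opp_lfunE; ring.
have D23 x y z : D x z y = - D x y z.
  rewrite /D /cocycle_defect (brC y z) linearN opp_lfunE; ring.
have Dxx x z : D x x z = 0.
  by rewrite /D /cocycle_defect brxx linear0 zero_lfunE add0r addrC subrr.
have Dlin a x x' y z : D (a *: x + x') y z = a * D x y z + D x' y z.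
  rewrite /D /cocycle_defect !(linearP, add_lfunE, scale_lfunE) /=.
  have scaleE (u v : k^o) : u *: v = u * v by [].
  by rewrite !scaleE; ring.
have Dsort i j l : (1 <= i <= 12)%N -> (i < j <= 12)%N -> (1 <= l <= 12)%N ->
    D (E i) (E j) (E l) = 0.
  move=> i12 j12 l12; case: (ltngtP j l) => [jl|lj|<-].
  - by apply: w0; lia.
  - rewrite D23; case: (ltngtP i l) => [il|li|<-]; last by rewrite Dxx oppr0.
      by rewrite w0 ?oppr0 //; lia.
    by rewrite D12 w0 ?oppr0 //; lia.
  - by rewrite D12 D23 D12 Dxx !oppr0.
move=> x y z; change (D x y z = 0).
elim/basis_ind: x => [a x x' IH IH'|i i12]; first by rewrite Dlin IH IH' mulr0 addr0.
rewrite D12; apply/eqP; rewrite oppr_eq0; apply/eqP.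
elim/basis_ind: y => [a y y' IH IH'|j j12]; first by rewrite Dlin IH IH' mulr0 addr0.
rewrite D23 D12; apply/eqP; rewrite !oppr_eq0; apply/eqP.
elim/basis_ind: z => [a z z' IH IH'|l l12]; first by rewrite Dlin IH IH' mulr0 addr0.
rewrite D12 D23; apply/eqP; rewrite !oppr_eq0; apply/eqP.
case: (ltngtP j i) => [ji|ij|->]; last by rewrite Dxx.
  by rewrite Dsort //; lia.
by rewrite D12 Dsort ?oppr0 //; lia.
Qed.

Hypothesis char0 : [pchar k] =i pred0.

Lemma alternating_basis (w : Defs.form g) :
  (forall i j, (1 <= i <= 12)%N -> (1 <= j <= 12)%N ->
     w (E j) (E i) = - w (E i) (E j)) -> alternating w.
Proof.
move=> wN; have wC x y : w y x = - w x y.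
  elim/basis_ind: x => [a x x' IH IH'|i i12].
    by rewrite !linearP /= add_lfunE scale_lfunE IH IH' ?scalerN ?opprD.
  elim/basis_ind: y => [a y y' IH IH'|j j12]; last exact: wN.
  by rewrite !linearP /= add_lfunE scale_lfunE IH IH' ?scalerN ?opprD.
move=> x; apply/eqP; have /eqP := wC x x.
by rewrite -addr_eq0 -mulr2n -mulr_natl mulf_eq0 (negPf (numeral_neq0 char0 _)).
Qed.

(** The only possible normalized cocycle with w(e_1, e_12) = c and w(e_i, e_(i+1)) = b_i for 2 <= i
    <= 6. *)
Definition wmat (c : k) (b : nat -> k) (i j : nat) : k :=
  if i == 1%N then (if j == 12 then c else 0)
  else if j == 1%N then (if i == 12 then - c else 0)
  else feval (env c b) (entry i j).

Definition wform c b : Defs.form g :=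
  bilin e (fun i j : 'I_12 => wmat c b i.+1 j.+1 : k^o).

Lemma wform_E c b i j : (1 <= i <= 12)%N -> (1 <= j <= 12)%N ->
  wform c b (E i) (E j) = wmat c b i j.
Proof. exact: bilin_E. Qed.

Lemma entry_gt i j : (i < j)%N -> entry j i = fopp (entry i j).
Proof. by move=> ij; rewrite /entry leqNgt ij ltnW. Qed.

Lemma wform_alternating c b : alternating (wform c b).
Proof.
apply: alternating_basis => i j i12 j12; rewrite !wform_E // /wmat.
case: (eqVneq i 1%N) => [i1|i1]; case: (eqVneq j 1%N) => [j1|j1]; rewrite ?i1 ?j1 /=.
- by rewrite oppr0.
- by case: ifP; rewrite ?oppr0.
- by case: ifP; rewrite ?opprK ?oppr0.
- case: (ltngtP i j) => [ij|ji|->].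
  + by rewrite (entry_gt ij) fevalN.
  + by rewrite (entry_gt ji) fevalN opprK.
  + by rewrite /entry leqnn subnn /feval !big_nil oppr0.
Qed.

(** The recursion of [entry_gap] is exactly closedness on (e_1, e_i, e_j). *)
Lemma entry_step c b i j : (2 <= i < j)%N ->
  feval (env c b) (entry i.+1 j) + feval (env c b) (entry i j.+1)
  = feval lam (brcoef i j 12) * c.
Proof.
move=> ij; rewrite /entry (_ : i < j)%N; [|lia].
rewrite (_ : i <= j.+1)%N; [|lia].
rewrite (_ : j.+1 - i = (j - i.+1).+2)%N /=; [|lia].
rewrite feval_cat fevalN fevalM feval_env_brcoef; [|lia..].
rewrite [LHS]addrC subrK feval_var mulrC; congr (feval _ (brcoef _ _ _) * _).
lia.
Qed.

(** Makes [entry_step] at j = 12 consistent with e_13 = 0. *)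
Lemma entry_13 i : (2 <= i <= 12)%N -> entry i 13 = [::].
Proof.
have : all (fun i => entry i 13 == [::]) (iota 2 11) by vm_compute.
by move=> /allP wf0 i12; apply/eqP/wf0; rewrite mem_iota; lia.
Qed.

(** Triples containing e_1 are closed by [entry_step], so only the others remain as hypotheses. *)
Lemma wform_Z2 c b :
  (forall i j l, (2 <= i < j)%N -> (j < l <= 12)%N ->
     feval (env c b) (cocpoly i j l) = 0) -> Z2 br (wform c b).
Proof.
move=> coc0; apply: Z2_basis => [|i j l ij jl]; first exact: wform_alternating.
rewrite /cocycle_defect; have [i2|i1] := leqP 2 i; last first.
  have -> : i = 1%N by lia.
  rewrite !br_1E ?form_br_E; [|lia..].
  rewrite (bigD1_seq 12%N) ?iota_uniq //= big1_seq ?addr0; last first.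
    move=> r /andP[r12]; rewrite mem_iota => r11; rewrite wform_E; [|lia..].
    by rewrite /wmat (negPf r12) (_ : r == 1%N = false) ?mulr0 //; lia.
  have -> : wform c b (E l.+1) (E j) = - feval (env c b) (entry j l.+1).
    have [l12|l12] := leqP 12 l; last first.
      rewrite wform_E; [|lia..]; rewrite /wmat ifF; [|lia]; rewrite ifF; [|lia].
      by rewrite -fevalN -entry_gt //; lia.
    have -> : l = 12 by lia.
    by rewrite E_overflow // linear0 zero_lfunE entry_13 ?/feval ?big_nil ?oppr0 //; lia.
  rewrite !wform_E; [|lia..]; rewrite {1}/wmat (_ : l == 1%N = false); [|lia].
  rewrite (_ : j.+1 == 1%N = false); [|lia].
  by rewrite opprK /wmat /= entry_step ?mulrN ?subrr //; lia.
rewrite !form_br_E; [|lia..]; rewrite -sumrB -big_split /=.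
rewrite -[RHS](@coc0 i j l) ?feval_cocpoly; [|lia..].
apply: eq_big_seq => r; rewrite mem_iota => r12.
have wfE' s : (2 <= s <= 12)%N -> wform c b (E r) (E s) = feval (env c b) (entry r s).
  move=> s12; rewrite wform_E; [|lia..]; rewrite /wmat.
  rewrite (_ : r == 1%N = false); [|lia].
  by rewrite (_ : s == 1%N = false) //; lia.
by rewrite !wfE' //; lia.
Qed.

(** Outside [exc], the cocycle equations hold because all their monomials contain an indeterminate
    that vanishes; this is checked by computation. *)
Lemma wform_Z2_restr keep (exc : seq (nat * nat * nat)) c b :
  all (fun t => (t \in exc) || (frestr keep (cocpoly t.1.1 t.1.2 t.2) == [::])) triples ->
  (forall a s, ~~ keep (a, s) -> env c b a s = 0) ->
  (forall i j l, (i, j, l) \in exc -> feval (env c b) (cocpoly i j l) = 0) ->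
  Z2 br (wform c b).
Proof.
move=> /allP nil env0 exc0; apply: wform_Z2 => i j l ij jl.
have /nil /= : (i, j, l) \in triples.
  rewrite mem_filter; apply/andP; split; first by rewrite /=; lia.
  by rewrite !allpairs_f // mem_iota; lia.
case/orP => [/exc0 //|/eqP nil_ijl].
by rewrite -(feval_restr _ env0) nil_ijl /feval big_nil.
Qed.

Definition is_normalized (v : Defs.form g) :=
  forall j, (2 <= j <= 11)%N -> v (E 1) (E j) = 0.

Lemma wform_normalized c b : is_normalized (wform c b).
Proof. by move=> j j12; rewrite wform_E ?/wmat /= ?ifF //; lia. Qed.

(** The matrix of omega_l as a multiple of b_(l+1). The extra sign is (-1)^(l+1) = omega_l(e_(l+1),
    e_(l+2)), the value to be assigned to b_(l+1). *)
Definition fomega (l i j : nat) : fpoly :=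
  if [&& 2 <= i, i <= (2 * l + 3) %/ 2 & i + j == 2 * l + 3]%N
  then [:: ((-1) ^+ (i + l.+1), [:: (0, l.+1)%N])]
  else if [&& 2 <= j, j <= (2 * l + 3) %/ 2 & i + j == 2 * l + 3]%N
  then [:: (- (-1) ^+ (j + l.+1), [:: (0, l.+1)%N])]
  else [::].

Definition only_b (l : nat) : pred (nat * nat) := fun v => (v.1 != 0)%N || (v.2 == l.+1).

Definition omega_b l (i : nat) : k := if i == l.+1 then (-1) ^+ l.+1 else 0.

(** When all parameters but b_(l+1) vanish, the recursion just alternates signs along one
    antidiagonal; the entries are compared by computation. *)
Lemma omega_wform l : (1 <= l <= 2)%N -> omega e l = wform 0 (omega_b l).
Proof.
move=> l12; have check : all (fun l => all (fun i => all (fun j =>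
    frestr (only_b l) (entry i j) == fomega l i j) (iota 2 11)) (iota 2 11)) (iota 1 2).
  by vm_compute.
have {}check i j : (2 <= i <= 12)%N -> (2 <= j <= 12)%N ->
    frestr (only_b l) (entry i j) = fomega l i j.
  move=> i12 j12; apply/eqP; move: check.
  have [l_i i_i j_i] : [/\ l \in iota 1 2, i \in iota 2 11 & j \in iota 2 11].
    by rewrite !mem_iota; split; lia.
  by move=> /allP/(_ l l_i)/allP/(_ i i_i)/allP/(_ j j_i).
have env0 a s : ~~ only_b l (a, s) -> env 0 (omega_b l) a s = 0.
  by rewrite /only_b /omega_b; case: a => [|a] //=; case: s => [|s] //= /negPf ->.
have sgn2 i : (-1) ^+ l.+1 * (-1) ^+ (i + l.+1) = (-1) ^+ i :> k.
  by rewrite -exprD addnCA addnn -mul2n exprD exprM sqrrN expr1n expr1n mulr1.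
apply: form_ext => i j i12 j12; rewrite wform_E // /omega.
rewrite (@bilin_E k^o (fun i j => omega_coef k l i j)) //.
rewrite /wmat; have [i2|i1] := leqP 2 i; last first.
  by rewrite /omega_coef ifF; [|lia]; rewrite ifF; [|lia]; rewrite ifT; [case: ifP|lia].
have [j2|j1] := leqP 2 j; last first.
  rewrite /omega_coef ifF; [|lia]; rewrite ifF; [|lia]; rewrite ifF; [|lia].
  by rewrite ifT; [case: ifP; rewrite ?oppr0|lia].
rewrite ifF; [|lia]; rewrite ifF; [|lia].
rewrite -(feval_restr _ env0) check; [|lia..]; rewrite /fomega /omega_coef.
have signE (m : nat) : ((-1) ^+ m : int)%:~R = (-1) ^+ m :> k.
  by rewrite rmorphXn /= rmorphN1.
case: ifP => _; last case: ifP => _; rewrite /feval ?big_nil // !big_seq1 /= /omega_b eqxx.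
  by rewrite -mulrzr signE sgn2.
by rewrite mulrNz -mulrzr signE sgn2.
Qed.

Lemma omega_Z2 l : (1 <= l <= 2)%N -> Z2 br (omega e l).
Proof.
move=> l12; rewrite omega_wform //; apply: (@wform_Z2_restr (only_b l) [::]) => //.
  have [->|->] : l = 1%N \/ l = 2 by lia.
  - by vm_compute.
  - by vm_compute.

by rewrite /only_b /omega_b => -[|a] [|s] //= /negPf ->.
Qed.

(** * Cohomology classes and their normalized representatives *)

Lemma Z2_linear a (v w : Defs.form g) : Z2 br v -> Z2 br w -> Z2 br (a *: v + w).
Proof.
move=> [valt v0] [walt w0]; split=> [x|x y z].
  by rewrite !add_lfunE !scale_lfunE valt walt scaler0 addr0.
rewrite !add_lfunE !scale_lfunE; have scaleE (u t : k^o) : u *: t = u * t by [].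
transitivity (a * (v (br x y) z - v (br x z) y + v (br y z) x)
              + (w (br x y) z - w (br x z) y + w (br y z) x)).
  by rewrite !scaleE; ring.
by rewrite v0 w0 mulr0 addr0.
Qed.

Lemma Z2_0 : Z2 br 0.
Proof. by split=> [x|x y z]; rewrite !zero_lfunE ?subrr ?addr0. Qed.

Lemma B2_linear a (v w : Defs.form g) : B2 br v -> B2 br w -> B2 br (a *: v + w).
Proof.
move=> [f vf] [h wh]; exists (a *: f + h) => x y.
by rewrite !add_lfunE !scale_lfunE vf wh.
Qed.

Lemma B2_Z2 (v : Defs.form g) : B2 br v -> Z2 br v.
Proof.
move=> [f vf]; split=> [x|x y z]; first by rewrite vf brxx linear0.
rewrite !vf -linearB -linearD /=; case: br_lie => _ /(_ x y z) jac0.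
by rewrite (brC x z) linearN opp_lfunE addrAC in jac0; rewrite jac0 linear0.
Qed.

Lemma span_Z2 (s : seq (Defs.form g)) (w : Defs.form g) :
  (forall v, v \in s -> Z2 br v) -> w \in <<s>>%VS -> Z2 br w.
Proof.
elim: s w => [|v s IH] w sZ2; first by rewrite span_nil memv0 => /eqP ->; apply: Z2_0.
rewrite span_cons => /memv_addP[_ /vlineP[a ->] [u us ->]].
apply: Z2_linear; first by apply: sZ2; rewrite mem_head.
by apply: IH us => x xs; apply: sZ2; rewrite inE xs orbT.
Qed.

(** As [e_1, e_j] = e_(j+1), the coboundary of f with f(e_(j+1)) = v(e_1, e_j) agrees with v on
    (e_1, e_j) for j < 12. *)
Lemma normalize (v : Defs.form g) : Z2 br v ->
  exists2 u, B2 br u & Z2 br (v - u) /\ is_normalized (v - u).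
Proof.
(* [bilin] with first argument frozen at e_1 defines f by its values on the basis; [E 0 = E 1] makes
   f(e_1) = 0. *)
move=> vZ2; pose f : 'Hom(g, k^o) :=
  bilin e (fun i j : 'I_12 => v (E 1) (E j.+1.-1)) (E 1).
have fE j : (1 <= j <= 12)%N -> f (E j) = v (E 1) (E j.-1).
  exact: (@bilin_E k^o (fun i j => v (E 1) (E j.-1)) 1 j).
pose u : Defs.form g := bilin e (fun i j : 'I_12 => f (br (E i.+1) (E j.+1))).
have uE x y : u x y = f (br x y).
  elim/basis_ind: x => [a x x' IH IH'|i i12].
    by rewrite !(linearP, add_lfunE, scale_lfunE) /= IH IH'.
  elim/basis_ind: y => [a y y' IH IH'|j j12].
    by rewrite !linearP /= IH IH'.
  exact: (@bilin_E k^o (fun i j => f (br (E i) (E j))) i j).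
have uB2 : B2 br u by exists f.
exists u => //; split; last first.
  move=> j j11; rewrite add_lfunE opp_lfunE add_lfunE opp_lfunE uE br_1E; [|lia].
  by rewrite fE ?subrr //; lia.
by rewrite addrC -scaleN1r; apply: Z2_linear => //; apply: B2_Z2.
Qed.

(** Every class has a normalized representative, so spanning need only be tested on normalized
    cocycles. *)
Lemma H2_span (s : seq (Defs.form g)) :
  (forall v, v \in s -> Z2 br v) ->
  (forall v, Z2 br v -> is_normalized v -> v \in <<s>>%VS) ->
  H2 br = cls_span br s.
Proof.
move=> sZ2 s_span; apply/seteqP; split=> _ [v vH <-]; last first.
  by exists v => //; apply: span_Z2 sZ2 vH.
have [u uB2 [vuZ2 vu_norm]] := normalize vH.
exists (v - u); first exact: s_span.
apply/seteqP; split=> w /=; rewrite /cls /=.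
  move=> wB2; have -> : w - v = (-1) *: u + (w - (v - u)).
    by rewrite scaleN1r opprB addrCA addKr.
  exact: B2_linear.
move=> wB2; have -> : w - (v - u) = 1 *: u + (w - v).
  by rewrite scale1r opprB addrCA.
exact: B2_linear.
Qed.

Definition not_c_b : pred (nat * nat) :=
  fun x => ~~ ((x.1 == 0)%N && (x.2 \in [:: 0; 2; 3; 4; 5; 6]%N)).

(** Every monomial of an entry contains c or one of b_2, ..., b_6, so these parameters determine a
    normalized cocycle. *)
Lemma entry_not_c_b i j : (2 <= i <= 12)%N -> (2 <= j <= 12)%N ->
  frestr not_c_b (entry i j) = [::].
Proof.
have /allP check : all (fun i =>
    all (fun j => frestr not_c_b (entry i j) == [::]) (iota 2 11)) (iota 2 11).
  by vm_compute.
move=> i12 j12; have /check/allP/(_ j) : i \in iota 2 11 by rewrite mem_iota; lia.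
by rewrite mem_iota => /(_ _)/eqP; apply; lia.
Qed.

Lemma normalized_eq0 (v : Defs.form g) : Z2 br v -> is_normalized v ->
  v (E 1) (E 12) = 0 -> (forall i, (2 <= i <= 6)%N -> v (E i) (E i.+1) = 0) ->
  v = 0.
Proof.
move=> vZ2 v1 c0 b0; have vN := alternatingN (proj1 vZ2).
have v1j j : (1 <= j <= 12)%N -> v (E 1) (E j) = 0.
  move=> j12; have [/v1 //|j_1_12] := boolP (2 <= j <= 11)%N.
  have [->|->] : j = 1%N \/ j = 12 by lia.
    exact: (proj1 vZ2).
  exact: c0.
apply: form_ext => i j i12 j12; rewrite !zero_lfunE.
have [i2|i1] := leqP 2 i; last first.
  by rewrite (_ : i = 1%N) ?v1j //; lia.
have [j2|j1] := leqP 2 j; last first.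
  by rewrite vN (_ : j = 1%N) ?v1j ?oppr0 //; lia.
rewrite (entryE vZ2 v1); [|lia..].
rewrite -(@feval_restr _ _ not_c_b) ?entry_not_c_b ?/feval ?big_nil //; [lia..|].
move=> [|a] s; rewrite /not_c_b /= ?negbK //; case: s => [|s] s26 /=; first exact: c0.
by apply: b0; move: s26; rewrite !inE; lia.
Qed.

(** * Explicit Jacobi and cocycle equations *)

(* Replaces a polynomial by its explicit list of monomials before unfolding feval. *)
Ltac expand_feval :=
  lazymatch goal with |- context [feval ?rho ?p] =>
    let q := eval vm_compute in p in
    let H := fresh in
    eassert (H : feval rho p = _);
      [rewrite (_ : p = q); [rewrite /feval unlock /=; reflexivity | by vm_compute]
      | rewrite H; clear H]
  end.

(** Give alpha_(a,s) the weight s - 2 a - 1. The coefficient of e_r in [e_i, e_j] has weight r - i -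
    j, so the e_s-component of the Jacobi identity on (e_i, e_j, e_l) is homogeneous of weight s - i
    - j - l. Only alpha_(6,12) has negative weight, namely -1. *)
Lemma jac_234_9 : 3 * lam 3 7 ^+ 2 = lam 4 9 * (2 * lam 2 5 + lam 3 7).
Proof.
have := @jacobi 2 3 4 9 isT isT isT isT; expand_feval => jac0.
by apply/eqP; rewrite -subr_eq0; apply/eqP; rewrite -[RHS]jac0; ring.
Qed.

Lemma jac_245_11 : 2 * lam 2 5 * lam 5 11
  = 4 * lam 3 7 * lam 4 9 + lam 3 7 * lam 5 11 - 6 * lam 4 9 ^+ 2 + lam 4 9 * lam 5 11.
Proof.
have := @jacobi 2 4 5 11 isT isT isT isT; expand_feval => jac0.
by apply/eqP; rewrite eq_sym -subr_eq0; apply/eqP; rewrite -[RHS]jac0; ring.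
Qed.

Lemma jac_345_12 : 3 * lam 3 7 * lam 5 11 + 3 * lam 4 9 * lam 5 11
  = 4 * lam 4 9 ^+ 2 + (2 * lam 3 8 + lam 4 10) * lam 6 12.
Proof.
have := @jacobi 3 4 5 12 isT isT isT isT; expand_feval => jac0.
by apply/eqP; rewrite eq_sym -subr_eq0; apply/eqP; rewrite -[RHS]jac0; ring.
Qed.

Lemma jac_238_12 : lam 6 12 * lam 5 11 = lam 6 12 * (3 * lam 3 7 - 2 * lam 2 5).
Proof.
have := @jacobi 2 3 8 12 isT isT isT isT; expand_feval => jac0.
by apply/eqP; rewrite eq_sym -subr_eq0; apply/eqP; rewrite -[RHS]jac0; ring.
Qed.

Lemma jac_234_10 : 2 * lam 2 5 * lam 4 10 + 3 * lam 2 6 * lam 4 9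
    + lam 3 7 * lam 4 10 + 3 * lam 3 8 * lam 4 9 = 7 * lam 3 7 * lam 3 8.
Proof.
have := @jacobi 2 3 4 10 isT isT isT isT; expand_feval => jac0.
by apply/eqP; rewrite eq_sym -subr_eq0; apply/eqP; rewrite -[RHS]jac0; ring.
Qed.

Lemma cocycle_238 c b : feval (env c b) (cocpoly 2 3 8) =
  (3 * lam 3 7 - 2 * lam 2 5 - lam 5 11) * b 6 + c * (
    - 2 * lam 2 5 * lam 4 9 + 6 * lam 2 5 * lam 5 11 + 3 * lam 3 7 ^+ 2
    - 13 * lam 3 7 * lam 4 9 - 7 * lam 3 7 * lam 5 11 + 30 * lam 4 9 ^+ 2
    - 27 * lam 4 9 * lam 5 11 + 10 * lam 5 11 ^+ 2
    + lam 6 12 * (11 * lam 3 8 - 3 * lam 2 6 + 3 * lam 4 10 - 5 * lam 5 12)).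
Proof. by expand_feval; ring. Qed.

Lemma cocycle_23_10 c b : feval (env c b) (cocpoly 2 3 10) = 5 * lam 6 12 ^+ 2 * c.
Proof. by expand_feval; ring. Qed.

(** For c = 0 the triples (2,3,7), (2,3,6), (2,3,4) constrain b_6, b_5, b_4 in turn. *)
Lemma cocycle_237 b : feval (env 0 b) (cocpoly 2 3 7) = (2 * lam 3 8 + lam 4 10) * b 6.
Proof. by expand_feval; ring. Qed.

Lemma cocycle_236 b : b 6 = 0 ->
  feval (env 0 b) (cocpoly 2 3 6) = (2 * lam 2 5 - lam 3 7 - lam 4 9) * b 5.
Proof. by move=> b6; expand_feval; rewrite b6; ring. Qed.

Lemma cocycle_234 b : b 6 = 0 -> b 5 = 0 ->
  feval (env 0 b) (cocpoly 2 3 4) = - (2 * lam 2 5 + lam 3 7) * b 4.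
Proof. by move=> b6 b5; expand_feval; rewrite b6 b5; ring. Qed.

(** For i + j = 13 the bracket is a multiple of alpha_(6,12) e_12; for larger i + j no basis vector
    is left. *)
Lemma br_high i j : (3 <= j <= 12)%N -> (j < i <= 12)%N ->
  (13 < i + j)%N || (lam 6 12 == 0) && (12 < i + j)%N -> br (E i) (E j) = 0.
Proof.
move=> j12 i12 ij; rewrite brC br_E; [|lia..]; rewrite big1_seq ?oppr0 // => r /=.
rewrite mem_iota => r12; have [ij13|ij13] := ltnP 13 (i + j).
  by rewrite brcoef_low ?scale0r //; lia.
have [r11|r11] := ltnP r 12; first by rewrite brcoef_low ?scale0r //; lia.
move: ij; rewrite ltnNge ij13 /= => /andP[/eqP a6 ij].
have -> : r = 12 by lia.
have iE : i = (13 - j)%N by lia.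
have [j3|[j3|[j3|j3]]] : j = 3 \/ j = 4 \/ j = 5 \/ j = 6 by lia.
all: by rewrite iE j3; expand_feval; rewrite a6 !mul0r ?mul0rz ?addr0 scale0r.
Qed.

(** * The lower central series and the properties (a), (b), (c) *)

Definition tailspan (m : nat) : {vspace g} := <<drop m e>>%VS.

Lemma tailspan_ind m (P : g -> Prop) : P 0 ->
  (forall a x y, P x -> P y -> P (a *: x + y)) ->
  (forall i, (m < i <= 12)%N -> P (E i)) -> forall x, x \in tailspan m -> P x.
Proof.
move=> P0 P_lin PE x; rewrite /tailspan -[drop m e]/(tval (in_tuple _)) => /coord_span ->.
elim/big_ind: _ => // [y z Py Pz|i _].
  by rewrite -[y]scale1r; apply: P_lin.
rewrite -[_ *: _]addr0; apply: P_lin => //; rewrite nth_drop; apply: (PE (m + i).+1).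
by have := ltn_ord i; have := size_drop m e; rewrite size_tuple; lia.
Qed.

Lemma E_tailspan m i : (m < i)%N -> E i \in tailspan m.
Proof.
move=> mi; have [i12|i12] := leqP i 12; last by rewrite E_overflow // mem0v.
apply: memv_span; have -> : E i = nth 0 (drop m e) (i - m.+1).
  by rewrite nth_drop /E; congr (nth _ _ _); lia.
by rewrite mem_nth // size_drop size_tuple; lia.
Qed.

Lemma tailspan_sub m (X : {vspace g}) :
  (forall i, (m < i <= 12)%N -> E i \in X) -> (tailspan m <= X)%VS.
Proof.
move=> EX; apply/subvP; apply: tailspan_ind => // [|a x y xX yX]; first exact: mem0v.
by rewrite rpredD ?rpredZ.
Qed.

Lemma tailspan0 : tailspan 0 = fullv.
Proof. by rewrite /tailspan drop0; apply: span_basis e_basis. Qed.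

Lemma brv_tailspan m n (X : {vspace g}) :
  (forall i j, (m < i <= 12)%N -> (n < j <= 12)%N -> br (E i) (E j) \in X) ->
  (brv br (tailspan m) (tailspan n) <= X)%VS.
Proof.
move=> brX; apply/brv_subP => u w; move: u; apply: tailspan_ind.
- by rewrite linear0 zero_lfunE mem0v.
- by move=> a x y xX yX wV; rewrite linearP add_lfunE scale_lfunE rpredD ?rpredZ ?xX ?yX.
move=> i i12; move: w; apply: tailspan_ind => [|a x y xX yX|j j12]; last exact: brX.
  by rewrite linear0 mem0v.
by rewrite linearP /= rpredD ?rpredZ.
Qed.

Lemma mem_brv (U W : {vspace g}) u w : u \in U -> w \in W -> br u w \in brv br U W.
Proof. by move=> uU wW; have /brv_subP := subvv (brv br U W); apply. Qed.

Lemma br_tailspan_lt i j c : (2 <= i < j)%N -> (j <= 12)%N ->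
  (forall r, (2 <= r <= c)%N -> feval lam (brcoef i j r) = 0) -> br (E i) (E j) \in tailspan c.
Proof.
move=> ij j12 cf0; rewrite br_E; [|lia..]; rewrite big_seq; apply: memv_suml => r.
rewrite mem_iota => r12; have [rc|cr] := leqP r c; last by rewrite memvZ // E_tailspan.
by rewrite cf0 ?scale0r ?mem0v //; lia.
Qed.

Lemma br_tailspan i j c : (2 <= i <= 12)%N -> (2 <= j <= 12)%N -> (c < i + j)%N -> (c < 12)%N ->
  br (E i) (E j) \in tailspan c.
Proof.
move=> i12 j12 cij c12; have [ij|ji|->] := ltngtP i j; last by rewrite brxx mem0v.
  by apply: br_tailspan_lt => [||r rc]; [lia|lia|rewrite brcoef_low //; lia].
by rewrite brC memvN; apply: br_tailspan_lt => [||r rc]; [lia|lia|rewrite brcoef_low //; lia].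
Qed.

(** Brackets raise indices as in [br_tailspan], and [e_1, e_(i-1)] = e_i gives the converse
    inclusion. The shift by one arises because e_2 is not a bracket. *)
Lemma lcsE j : (j <= 9)%N -> lcs br j.+1 = tailspan j.+2.
Proof.
elim: j => [_|j IH j9] /=; last rewrite -/(lcs br j.+1) IH; last by lia.
  rewrite -tailspan0; apply: subv_anti; apply/andP; split.
    apply: brv_tailspan => i j i12 j12.
    have [->|i2] : i = 1%N \/ (2 <= i)%N by lia.
      have [->|j2] : j = 1%N \/ (2 <= j)%N by lia.
        by rewrite brxx mem0v.
      by rewrite br_1E ?E_tailspan //; lia.
    have [->|j2] : j = 1%N \/ (2 <= j)%N by lia.
      by rewrite brC memvN br_1E ?E_tailspan //; lia.
    by apply: br_tailspan; lia.
  apply: tailspan_sub => i i12; rewrite (_ : i = i.-1.+1); [|lia].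
  by rewrite -br_1E; [|lia]; apply: mem_brv; apply: E_tailspan; lia.
rewrite -tailspan0; apply: subv_anti; apply/andP; split.
  apply: brv_tailspan => i l i12 l12.
  have [->|l2] : l = 1%N \/ (2 <= l)%N by lia.
    by rewrite brC memvN br_1E ?E_tailspan //; lia.
  by apply: br_tailspan; lia.
apply: tailspan_sub => i i12; rewrite (_ : i = i.-1.+1); [|lia].
rewrite -br_1E; [|lia]; rewrite brC memvN.
by apply: mem_brv; apply: E_tailspan; lia.
Qed.

Lemma dim_g : \dim {:g} = 12.
Proof. exact: size_basis e_basis. Qed.

Lemma coord_tailspan m (i : 'I_12) x : (i < m)%N -> x \in tailspan m -> coord e i x = 0.
Proof.
move=> im; move: x; apply: tailspan_ind => [|a x y x0 y0|j j12]; first exact: linear0.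
  by rewrite linearP /= x0 y0 mulr0 addr0.
have j11 : (j.-1 < 12)%N by lia.
rewrite /E (coord_free (Ordinal j11) i e_free) -val_eqE /= (_ : _ == _ = false) //; lia.
Qed.

(** If alpha_(2,5) = 0, the span of e_2, ..., e_12 violates (a): of the brackets involved only
    [e_2, e_3] could have an e_5-component. *)
Lemma propA_law : propA br -> lam 2 5 != 0.
Proof.
move=> A; apply/eqP => t0; apply: A; exists (tailspan 1); split.
- have : free (drop 1 e) by have := e_free; rewrite -{1}(cat_take_drop 1 e) cat_free => /and3P[].
  by rewrite /free => /eqP; rewrite -/(tailspan 1) => ->; rewrite size_drop size_tuple dim_g.
- by rewrite lcsE //; apply: tailspan_sub => i i12; apply: E_tailspan; lia.
- rewrite !lcsE //; apply: brv_tailspan => i j i12 j12.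
  have [ij|ij] := leqP (i + j) 5; last by apply: br_tailspan; lia.
  have [-> ->] : i = 2 /\ j = 3 by lia.
  apply: br_tailspan_lt => // r r5; have [r4|r4] := leqP r 4; first by rewrite brcoef_low //; lia.
  have -> : r = 5 by lia.
  by expand_feval; rewrite t0; ring.
Qed.

(** g^4 is spanned by e_6, ..., e_12, and [e_6, e_7] = alpha_(6,12) e_12 is its only bracket that
    can be nonzero, up to sign. *)
Lemma propB_law : propB br <-> lam 6 12 = 0.
Proof.
rewrite /propB dim_g (_ : (12 - 4) %/ 2 = 4)%N // lcsE //; split=> [B|a6].
  have : br (E 6) (E 7) = 0.
    by apply/eqP; rewrite -memv0 -B; apply: mem_brv; apply: E_tailspan.
  rewrite br_E // => /E_coef_eq0/(_ 12 isT); expand_feval => coef0; rewrite -[RHS]coef0; ring.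
apply/eqP; rewrite -subv0; apply: brv_tailspan => i j i12 j12; rewrite memv0; apply/eqP.
have [ij|ji|->] := ltngtP i j; last exact: brxx.
  by rewrite brC br_high ?oppr0 ?a6 ?eqxx //; lia.
by rewrite br_high ?a6 ?eqxx //; lia.
Qed.

(** g^6 starts at e_8, and alpha_(3,7) is the e_7-coefficient of [e_3, e_4], the only
    obstruction. *)
Lemma propC_law : propC br <-> lam 3 7 = 0.
Proof.
rewrite /propC !lcsE //; split=> [C|x0].
  have : br (E 3) (E 4) \in tailspan 7.
    by apply: (subvP C); apply: mem_brv; apply: E_tailspan.
  have i6 : (6 < 12)%N by [].
  move=> /(@coord_tailspan 7 (Ordinal i6) _ isT); rewrite br_E // linear_sum /=.
  rewrite (bigD1_seq 7%N) ?iota_uniq //= big1_seq.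
    rewrite linearZ /= /E (coord_free (Ordinal i6) _ e_free) eqxx mulr1 addr0.
    by expand_feval => coef0; rewrite -[RHS]coef0; ring.
  move=> r /andP[r7]; rewrite mem_iota => r12; have r11 : (r.-1 < 12)%N by lia.
  rewrite linearZ /= /E (coord_free (Ordinal r11) _ e_free) -val_eqE /=.
  by rewrite (_ : _ == _ = false) ?mulr0 //; lia.
have br34 : br (E 3) (E 4) \in tailspan 7.
  apply: br_tailspan_lt => // r r7; have [r6|r6] := leqP r 6; first by rewrite brcoef_low //; lia.
  have -> : r = 7 by lia.
  by expand_feval; rewrite x0; ring.
apply: brv_tailspan => i j i12 j12; have [ij|ij] := leqP (i + j) 7; last by apply: br_tailspan; lia.
have [[-> ->]|[[-> ->]|[-> ->]]] :
  (i = 3 /\ j = 4) \/ (i = 4 /\ j = 3) \/ (i = 3 /\ j = 3) by lia.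
- by [].
- by rewrite brC memvN.
- by rewrite brxx mem0v.
Qed.

(** * Uniqueness of normalized cocycles with given c, b_2, b_3 *)

Hypothesis a25 : lam 2 5 != 0.

(** The equations are triangular: (2,3,6) gives b_5 = 0, then (2,3,4) gives b_4 = 0. *)
Lemma normalized_unique (v : Defs.form g) : Z2 br v -> is_normalized v ->
  v (E 1) (E 12) = 0 -> v (E 2) (E 3) = 0 -> v (E 3) (E 4) = 0 ->
  v (E 6) (E 7) = 0 -> 2 * lam 2 5 - lam 3 7 - lam 4 9 != 0 -> v = 0.
Proof.
move=> vZ2 v1 c0 b2 b3 b6 D5; apply: normalized_eq0 => //.
have coc0 := cocycle_eq vZ2 v1; rewrite c0 in coc0.
have b5 : v (E 5) (E 6) = 0.
  have := coc0 2 3 6 isT isT isT; rewrite cocycle_236 // => /eqP.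
  by rewrite mulf_eq0 (negPf D5) => /eqP.
have b4 : v (E 4) (E 5) = 0.
  have := coc0 2 3 4 isT isT isT; rewrite cocycle_234 // => /eqP.
  by rewrite mulf_eq0 oppr_eq0 (negPf (sum2tx_neq0 char0 a25 jac_234_9)) => /eqP.
by move=> i i6; have [->|[->|[->|[->|->]]]] :
  i = 2 \/ i = 3 \/ i = 4 \/ i = 5 \/ i = 6 by lia.
Qed.

Lemma normalized_span (s : seq (Defs.form g)) (v w : Defs.form g) :
  2 * lam 2 5 - lam 3 7 - lam 4 9 != 0 ->
  (forall u, Z2 br u -> is_normalized u -> u (E 1) (E 12) = 0 -> u (E 6) (E 7) = 0) ->
  omega e 1 \in <<s>>%VS -> omega e 2 \in <<s>>%VS -> w \in <<s>>%VS ->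
  Z2 br w -> is_normalized w ->
  w (E 1) (E 12) = v (E 1) (E 12) -> w (E 2) (E 3) = 0 -> w (E 3) (E 4) = 0 ->
  Z2 br v -> is_normalized v -> v \in <<s>>%VS.
Proof.
move=> D5 b6 o1s o2s ws wZ2 w1 wc w2 w3 vZ2 v1.
(* This matches b_2, b_3 and c of v; the minus sign is due to omega_2(e_3, e_4) = -1. *)
pose r := v (E 2) (E 3) *: omega e 1 + (- v (E 3) (E 4) *: omega e 2 + w).
pose u := (-1) *: r + v.
have uE x y : u x y = - (v (E 2) (E 3) * omega e 1 x y
    + (- v (E 3) (E 4) * omega e 2 x y + w x y)) + v x y.
  by rewrite !(add_lfunE, scale_lfunE) scaleN1r.
have o1E := omega_wform (isT : 1 <= 1 <= 2)%N.
have o2E := omega_wform (isT : 1 <= 2 <= 2)%N.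
have u1 : is_normalized u.
  move=> j j11; rewrite uE v1 // w1 // o1E o2E !wform_normalized //.
  by rewrite !mulr0 !addr0 oppr0.
have uZ2 : Z2 br u.
  by do !apply: Z2_linear => //; apply: omega_Z2.
have uc : u (E 1) (E 12) = 0.
  by rewrite uE wc o1E o2E !wform_E // /wmat /= !mulr0 !add0r addNr.
have u0 : u = 0.
  apply: normalized_unique => //; last exact: b6.
    rewrite uE w2 o1E o2E !wform_E // /wmat /= !feval_var /= /omega_b /=.
    by rewrite expr2 mulrNN !mulr1 mulr0 !addr0 addNr.
  rewrite uE w3 o1E o2E !wform_E // /wmat /= !feval_var /= /omega_b /=.
  by rewrite mulr0 add0r addr0; ring.
have -> : v = r by apply/eqP; rewrite -subr_eq0 addrC -scaleN1r -/u u0.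
by rewrite !(rpredD, rpredZ).
Qed.

(** The list is indexed from 0, so b_2 = b_3 = 0; beyond index 6 the default 0 applies. *)
Definition three_b (b4 b5 b6 : k) (i : nat) : k := nth 0 [:: 0; 0; 0; 0; b4; b5; b6] i.

(** * Existence of a cocycle with c = 1 when alpha_(6,12) = 0 *)

Section SubdiagonalLaw.
Hypothesis a6_12 : lam 6 12 = 0.

Lemma jac_245_12 : 2 * lam 2 5 * lam 5 12 + 3 * lam 2 6 * lam 5 11
  = 5 * lam 3 7 * lam 4 10 + lam 3 7 * lam 5 12 + 4 * lam 3 8 * lam 4 9
    + 2 * lam 3 8 * lam 5 11 - 16 * lam 4 9 * lam 4 10
    + 4 * lam 4 10 * lam 5 11 + lam 4 9 * lam 5 12.
Proof.
have := @jacobi 2 4 5 12 isT isT isT isT; expand_feval; rewrite a6_12 => jac0.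
by apply/eqP; rewrite eq_sym -subr_eq0; apply/eqP; rewrite -[RHS]jac0; ring.
Qed.

Lemma weight_zero_law :
  [/\ lam 3 7 = 0, lam 4 9 = 0 & lam 5 11 = 0] \/
  [/\ lam 5 11 != 0, lam 2 5 = 420 * lam 5 11, lam 3 7 = 42 * lam 5 11
    & lam 4 9 = 6 * lam 5 11].
Proof.
apply: (weight_zero_cases char0 a25 jac_234_9 jac_245_11).
by rewrite jac_345_12 a6_12 mulr0 addr0.
Qed.

(** Once the weight-zero constants are known, [jac_234_10] and [jac_245_12] are linear and determine
    alpha_(4,10), then alpha_(5,12). *)
Lemma weight_one_law :
  lam 3 7 = 0 /\ lam 4 10 = 0 /\ lam 5 12 = 0 \/
  lam 3 7 <> 0 /\ lam 4 10 = (46 * lam 3 8 - 3 * lam 2 6) / 147 /\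
  lam 5 12 = (118 * lam 4 10 + 26 * lam 3 8 - 3 * lam 2 6) / 792.
Proof.
have [[x0 y0 z0]|[z0 tz xz yz]] := weight_zero_law; [left|right].
  have := jac_234_10; have := jac_245_12.
  rewrite x0 y0 z0 !(mulr0, mul0r, addr0, add0r, subr0, oppr0) => /eqP h5 /eqP h4.
  have a25' : 2 * lam 2 5 != 0 by rewrite mulf_neq0 ?numeral_neq0.
  move: h5; rewrite mulf_eq0 (negPf a25') => /eqP ->.
  by move: h4; rewrite mulf_eq0 (negPf a25') => /eqP ->.
split.
  by apply/eqP; rewrite xz mulf_neq0 // numeral_neq0.
have z6 : 6 * lam 5 11 != 0 by rewrite mulf_neq0 // numeral_neq0.
have a410 : lam 4 10 = (46 * lam 3 8 - 3 * lam 2 6) / 147.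
  apply: (mulfI z6); apply: (mulfI (@numeral_neq0 _ char0 147 isT)).
  apply: (eq_combination (c1 := 1) jac_234_10 (c2 := 0) (erefl 0)).
  by rewrite xz yz tz; field; rewrite !numeral_neq0.
split=> //.
apply: (mulfI z0); apply: (mulfI (@numeral_neq0 _ char0 792 isT)).
apply: (eq_combination (c1 := 1) jac_245_12 (c2 := 0) (erefl 0)).
by rewrite xz yz tz; field; rewrite !numeral_neq0.
Qed.

Lemma cocycle_236_b5 c b4 b5 b6 :
  feval (env c (three_b b4 b5 b6)) (cocpoly 2 3 6) =
  feval (env c (three_b 0 0 b6)) (cocpoly 2 3 6) + (2 * lam 2 5 - lam 3 7 - lam 4 9) * b5.
Proof. by do 2 expand_feval; rewrite /three_b /=; ring. Qed.

Lemma cocycle_234_b4 c b4 b5 b6 :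
  feval (env c (three_b b4 b5 b6)) (cocpoly 2 3 4) =
  feval (env c (three_b 0 b5 b6)) (cocpoly 2 3 4) - (2 * lam 2 5 + lam 3 7) * b4.
Proof. by do 2 expand_feval; rewrite /three_b /=; ring. Qed.

(* Two of the cocycle equations coincide with components of the Jacobi identity. *)
Lemma cocycle_235 b : feval (env 1 b) (cocpoly 2 3 5) = feval lam (jacpoly 2 3 4 12).
Proof. by do 2 expand_feval; rewrite a6_12; ring. Qed.

Lemma cocycle_245 b :
  feval (env 1 b) (cocpoly 2 4 5) + feval (env 1 b) (cocpoly 2 3 6) = feval lam (jacpoly 2 3 4 11).
Proof. by do 3 expand_feval; rewrite a6_12; ring. Qed.

(** The triples (2,3,8), (2,3,6), (2,3,4) prescribe b_6, b_5, b_4 successively; the other equations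
    then follow from the Jacobi identity. *)
Lemma cocycle_exists : exists b4 b5 b6, Z2 br (wform 1 (three_b b4 b5 b6)) /\
  (lam 3 7 != 0 -> b6 = 2 * lam 5 11 / 11).
Proof.
have D4 := sum2tx_neq0 char0 a25 jac_234_9.
have D5 : 2 * lam 2 5 - lam 3 7 - lam 4 9 != 0.
  have [[x0 y0 z0]|[z0 tz xz yz]] := weight_zero_law.
    by rewrite x0 y0 !subr0 mulf_neq0 ?numeral_neq0.
  rewrite tz xz yz (_ : _ - _ = 792 * lam 5 11); last by ring.
  by rewrite mulf_neq0 ?numeral_neq0.
(* In the second branch (2,3,8) reads - 715 z b_6 + 130 z^2 = 0; in the first one z = 0, and the
   same formula gives b_6 = 0. *)
pose b6 := 2 * lam 5 11 / 11.
pose b5 := - feval (env 1 (three_b 0 0 b6)) (cocpoly 2 3 6) / (2 * lam 2 5 - lam 3 7 - lam 4 9).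
pose b4 := feval (env 1 (three_b 0 b5 b6)) (cocpoly 2 3 4) / (2 * lam 2 5 + lam 3 7).
exists b4, b5, b6; split=> //.
have coc236 : feval (env 1 (three_b b4 b5 b6)) (cocpoly 2 3 6) = 0.
  by rewrite cocycle_236_b5 /b5 mulrC divfK // addrN.
have coc234 : feval (env 1 (three_b b4 b5 b6)) (cocpoly 2 3 4) = 0.
  by rewrite cocycle_234_b4 /b4 mulrC divfK // subrr.
have coc235 : feval (env 1 (three_b b4 b5 b6)) (cocpoly 2 3 5) = 0.
  by rewrite cocycle_235 jacobi.
have coc245 : feval (env 1 (three_b b4 b5 b6)) (cocpoly 2 4 5) = 0.
  by rewrite -[LHS]addr0 -{1}coc236 cocycle_245 jacobi.
apply: (@wform_Z2_restr no_a6 [:: (2, 3, 4); (2, 3, 5); (2, 3, 6); (2, 3, 7);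
  (2, 3, 8); (2, 4, 5); (2, 4, 6); (2, 4, 7); (2, 5, 6); (3, 4, 5); (3, 4, 6)]%N).
- by vm_compute.
- by move=> a s; rewrite /no_a6 negbK => /andP[/eqP /= -> /eqP /= ->].
move=> i j l; rewrite !inE.
have b6E : three_b b4 b5 b6 6 = 2 * lam 5 11 / 11 by [].
move: (three_b b4 b5 b6) b6E coc234 coc235 coc236 coc245 => b b6E ? ? ? ?.
have wt0 := weight_zero_law; have wt1 := weight_one_law.
have n11 : 11%:R != 0 :> k by rewrite numeral_neq0.
have n147 : 147%:R != 0 :> k by rewrite numeral_neq0.
have n792 : 792%:R != 0 :> k by rewrite numeral_neq0.
(* Four triples close by assumption; the other seven are identities in each branch. *)
do ![case/predU1P => [[-> -> ->]//|]]; last move=> /eqP[-> -> ->].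
all: expand_feval; rewrite a6_12 ?b6E.
(* alpha_(3,7) is zero exactly in the first branch, so the mixed combinations are contradictory. *)
all: case: wt0 => [[x0 y0 z0]|[z0 tz xz yz]]; case: wt1 => [[x0' [a4 a5]]|[x0' [a4 a5]]];
  try by [case: x0'|case/eqP: (mulf_neq0 (@numeral_neq0 _ char0 42 isT) z0); rewrite -xz].
all: rewrite ?a5 ?a4 ?tz ?xz ?yz ?x0 ?y0 ?z0; by field; rewrite ?n11 ?n147 ?n792.
Qed.

End SubdiagonalLaw.

(** * Values on commuting pairs and Gram determinants *)

Lemma E_neq0 i : (1 <= i <= 12)%N -> E i != 0.
Proof.
move=> i12; apply: (free_not0 e_free); rewrite mem_nth // size_tuple; lia.
Qed.

(** Subtracting a coboundary does not change values on commuting pairs, so the formulas for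
    normalized cocycles apply there. *)
Lemma form_high (v : Defs.form g) : Z2 br v ->
  exists2 v', Z2 br v' /\ is_normalized v' & forall i j, (3 <= j <= 12)%N ->
    (j < i <= 12)%N -> (13 < i + j)%N || (lam 6 12 == 0) && (12 < i + j)%N ->
    v (E i) (E j) = v' (E i) (E j).
Proof.
move=> vZ2; have [u [f uf] v'P] := normalize vZ2; exists (v - u) => // i j j12 i12 ij.
by rewrite add_lfunE opp_lfunE add_lfunE opp_lfunE uf br_high // linear0 subr0.
Qed.

(** Reversing the order of the rows makes the Gram matrix triangular. *)
Lemma det_gram (v : Defs.form g) :
  (forall i j, (1 <= i <= 12)%N -> (1 <= j <= 12)%N -> (13 < i + j)%N -> v (E i) (E j) = 0) ->
  (forall i, (1 <= i <= 12)%N -> v (E (13 - i)) (E i) != 0) ->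
  \det (gram e v) != 0.
Proof.
move=> v0 vd; pose s : {perm 'I_12} := perm (@rev_ord_inj 12).
have trig : is_trig_mx (row_perm s (gram e v)).
  apply/is_trig_mxP => i j ij; rewrite !mxE permE (ordE (rev_ord i)) ordE.
  apply: v0; rewrite /=; have := ltn_ord j; lia.
have : \det (row_perm s (gram e v)) != 0.
  rewrite det_trig //; apply/prodf_neq0 => i _; rewrite !mxE permE (ordE (rev_ord i)) ordE.
  have := ltn_ord i => i12; rewrite (_ : (rev_ord i).+1 = 13 - i.+1)%N ?vd //=; lia.
by rewrite row_permE det_mulmx mulf_eq0 negb_or => /andP[].
Qed.

Lemma nondegenerate_gram (v : Defs.form g) : \det (gram e v) != 0 -> Defs.nondegenerate v.
Proof.
move=> det_neq0 x x0; pose c : 'rV[k]_12 := \row_i coord e i x.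
have xE : x = \sum_i coord e i x *: e`_i by rewrite -(coord_basis e_basis (memvf x)).
have c0 : c = 0.
  have : c *m gram e v = 0.
    apply/rowP => j; rewrite !mxE -[RHS](x0 e`_j) [in RHS]xE linear_sum sum_lfunE.
    by apply: eq_bigr => i _; rewrite !mxE linearZ /= scale_lfunE.
  move=> /(congr1 (mulmx^~ (invmx (gram e v)))); rewrite mul0mx mulmxK //.
  by rewrite unitmxE unitfE.
rewrite xE big1 // => i _; have := congr1 (fun w : 'rV[k]_12 => w 0 i) c0.
by rewrite !mxE => ->; rewrite scale0r.
Qed.

(** * Cohomology when alpha_(6,12) is nonzero *)

Section SuperdiagonalLaw.
Hypothesis a6_12 : lam 6 12 != 0.

Lemma normalized_c_eq0 (v : Defs.form g) : Z2 br v -> is_normalized v ->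
  v (E 1) (E 12) = 0.
Proof.
move=> vZ2 v1; have := cocycle_eq vZ2 v1 (i := 2) (j := 3) (l := 10) isT isT isT.
rewrite cocycle_23_10 => /eqP; rewrite mulf_eq0 => /orP[|/eqP //].
by rewrite mulf_eq0 expf_eq0 (negPf a6_12) (negPf (numeral_neq0 char0 _)).
Qed.

Lemma z_superdiagonal : lam 5 11 = 3 * lam 3 7 - 2 * lam 2 5.
Proof. by apply: (mulfI a6_12); apply: jac_238_12. Qed.

(** If b_6 <> 0, [cocycle_237] removes the alpha_(6,12) term from [jac_345_12], so
    [weight_zero_cases] applies; both its cases contradict z = 3 x - 2 t. *)
Lemma normalized_b6_eq0 (v : Defs.form g) : Z2 br v -> is_normalized v ->
  v (E 6) (E 7) = 0.
Proof.
move=> vZ2 v1; have := cocycle_eq vZ2 v1 (i := 2) (j := 3) (l := 7) isT isT isT.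
rewrite normalized_c_eq0 // cocycle_237 => /eqP; rewrite mulf_eq0 => /orP[/eqP u0|/eqP //].
have := weight_zero_cases char0 a25 jac_234_9 jac_245_11.
rewrite jac_345_12 u0 mul0r addr0 => /(_ erefl).
have := z_superdiagonal => z3; case=> [[x0 _ z0]|[z0 t420 x42 _]].
  move: z3 => /eqP; rewrite z0 x0 mulr0 sub0r eq_sym oppr_eq0 mulf_eq0 (negPf a25) orbF.
  by rewrite (negPf (numeral_neq0 char0 _)).
suff : 715 * lam 5 11 == 0 by rewrite mulf_eq0 (negPf z0) (negPf (numeral_neq0 char0 _)).
apply/eqP; apply: (eq_combination (c1 := 1) z3 (c2 := 0) (erefl 0)).
by rewrite t420 x42; ring.
Qed.

Lemma H2_superdiagonal : H2 br = cls_span br [:: omega e 1; omega e 2].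
Proof.
apply: H2_span => [v|v vZ2 v1].
  by rewrite !inE => /orP[] /eqP ->; apply: omega_Z2.
(* As c = 0, no third generator is needed. *)
apply: (@normalized_span _ v 0) => //.
- exact: (b5_coef_neq0 char0 a25 jac_234_9 jac_245_11 z_superdiagonal).
- by move=> u uZ2 u1 _; apply: normalized_b6_eq0.
- by rewrite memv_span // !inE eqxx.
- by rewrite memv_span // !inE eqxx orbT.
- exact: mem0v.
- exact: Z2_0.
- by move=> j _; rewrite !zero_lfunE.
- by rewrite !zero_lfunE normalized_c_eq0.
- by rewrite !zero_lfunE.
- by rewrite !zero_lfunE.
Qed.

(** e_12 is central, so v(e_12, .) is unchanged by normalization. Its values on e_1 and e_2 are
    multiples of c = 0, the others vanish by [cocycle_high]. *)
Lemma not_symplectic_superdiagonal : ~ symplectic br.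
Proof.
move=> [v vZ2 v_nondeg]; have [u [f uf] [wZ2 w1]] := normalize vZ2.
have /eqP := E_neq0 (isT : 1 <= 12 <= 12)%N; apply; apply: v_nondeg => y.
have wN := alternatingN (proj1 wZ2).
elim/basis_ind: y => [a y y' IH IH'|j j12].
  by rewrite linearP /= IH IH' scaler0 addr0.
have -> : v (E 12) (E j) = (v - u) (E 12) (E j).
  rewrite add_lfunE opp_lfunE add_lfunE opp_lfunE uf.
  suff -> : br (E 12) (E j) = 0 by rewrite linear0 subr0.
  have [->|[->|[->|j3]]] : j = 1%N \/ j = 2 \/ j = 12 \/ (3 <= j <= 11)%N by lia.
  - by rewrite brC br_1E // E_overflow ?oppr0.
  - rewrite brC br_E // big1_seq ?oppr0 // => r /=; rewrite mem_iota => r12.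
    by rewrite brcoef_low ?scale0r //; lia.
  - exact: brxx.
  - by rewrite br_high //; lia.
have c0 := normalized_c_eq0 wZ2 w1.
have [->|[->|[->|j3]]] : j = 1%N \/ j = 2 \/ j = 12 \/ (3 <= j <= 11)%N by lia.
- by rewrite wN c0 oppr0.
- rewrite wN (entryE wZ2 w1) // c0; expand_feval.
  by rewrite /env /= ?(mul0r, mulr0, mul0rz, addr0, oppr0).
- exact: (proj1 wZ2).
- by rewrite wN (cocycle_high wZ2 w1) ?oppr0 //; lia.
Qed.

End SuperdiagonalLaw.

(** * Cohomology when alpha_(6,12) = 0 *)

Section SubdiagonalCohomology.
Hypothesis a6_12 : lam 6 12 = 0.

(** In [cocycle_238] the c-term vanishes, and the coefficient of b_6 is - 2 t or - 715 z, according
    to the branch. *)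
Lemma b6_subdiagonal (v : Defs.form g) : Z2 br v -> is_normalized v ->
  v (E 1) (E 12) = 0 \/ lam 3 7 = 0 -> v (E 6) (E 7) = 0.
Proof.
move=> vZ2 v1; have := cocycle_eq vZ2 v1 (i := 2) (j := 3) (l := 8) isT isT isT.
rewrite cocycle_238 a6_12 mul0r addr0.
have [[x0 y0 z0] coc0 _|[z0 t420 x42 y6] coc0 [c0|/eqP]] := weight_zero_law a6_12.
- apply: (mulfI (mulf_neq0 (@numeral_neq0 _ char0 2 isT) a25)).
  apply: (eq_combination (c1 := -1) coc0 (c2 := 0) (erefl 0)).
  by rewrite x0 y0 z0; ring.
- apply: (mulfI (mulf_neq0 (@numeral_neq0 _ char0 715 isT) z0)).
  apply: (eq_combination (c1 := -1) coc0 (c2 := 0) (erefl 0)).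
  by rewrite c0 x42 t420; ring.
- by rewrite x42 mulf_eq0 (negPf z0) (negPf (numeral_neq0 char0 _)).
Qed.

Lemma H2_subdiagonal b4 b5 b6 : Z2 br (wform 1 (three_b b4 b5 b6)) ->
  H2 br = cls_span br [:: omega e 1; omega e 2; wform 1 (three_b b4 b5 b6)].
Proof.
move=> wZ2; apply: H2_span => [v|v vZ2 v1].
  by rewrite !inE => /or3P[] /eqP -> //; apply: omega_Z2.
apply: (@normalized_span _ v (v (E 1) (E 12) *: wform 1 (three_b b4 b5 b6))) => //.
- have [[-> -> _]|[z0 -> -> ->]] := weight_zero_law a6_12.
    by rewrite !subr0 mulf_neq0 ?numeral_neq0.
  rewrite (_ : _ - _ = 792 * lam 5 11); last by ring.
  by rewrite mulf_neq0 ?numeral_neq0.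
- by move=> u uZ2 u1 c0; apply: b6_subdiagonal => //; left.
- by rewrite memv_span // !inE eqxx.
- by rewrite memv_span // !inE eqxx orbT.
- by rewrite memvZ // memv_span // !inE eqxx !orbT.
- by rewrite -[_ *: _]addr0; apply: Z2_linear => //; apply: Z2_0.
- by move=> j j11; rewrite !scale_lfunE wform_normalized // scaler0.
- by rewrite !scale_lfunE wform_E // /wmat /= [LHS]mulr1.
- by rewrite !scale_lfunE wform_E // /wmat /= feval_var scaler0.
- by rewrite !scale_lfunE wform_E // /wmat /= feval_var scaler0.
Qed.

(** Below the antidiagonal only coefficients of negative weight occur, that is alpha_(6,12). *)
Lemma entry_no_a6 i j : (2 <= i <= 12)%N -> (2 <= j <= 12)%N -> (13 < i + j)%N ->
  frestr no_a6 (entry i j) = [::].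
Proof.
have /allP check : all (fun i => all (fun j =>
    (13 < i + j)%N ==> (frestr no_a6 (entry i j) == [::])) (iota 2 11)) (iota 2 11).
  by vm_compute.
move=> i12 j12 ij; have /check/allP/(_ j) : i \in iota 2 11 by rewrite mem_iota; lia.
by rewrite ij mem_iota => /(_ _)/eqP; apply; lia.
Qed.

Lemma antidiagonal_neq0 b4 b5 i : lam 3 7 != 0 -> (2 <= i <= 6)%N ->
  feval (env 1 (three_b b4 b5 (2 * lam 5 11 / 11))) (entry i (13 - i)) != 0.
Proof.
move=> x_neq0 i6; have n11 : 11%:R != 0 :> k by rewrite numeral_neq0.
have [[x0 _ _]|[z0 t420 x42 y6]] := weight_zero_law a6_12; first by rewrite x0 eqxx in x_neq0.
(* Antidiagonal values in units of z / 11, obtained by the recursion from b_6 = 2 z / 11; the two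
   leading zeros are fillers. *)
pose q := nth 0%N [:: 0; 0; 2268; 196; 35; 9; 2]%N i.
suff -> : feval (env 1 (three_b b4 b5 (2 * lam 5 11 / 11))) (entry i (13 - i))
    = q%:R * (lam 5 11 / 11).
  rewrite mulf_neq0 ?mulf_neq0 ?invr_eq0 // numeral_neq0 // /q.
  by case: i i6 {q} => [|[|[|[|[|[|[|i]]]]]]].
rewrite /q {q}; have [->|[->|[->|[->|->]]]] :
  i = 2 \/ i = 3 \/ i = 4 \/ i = 5 \/ i = 6 by lia.
all: expand_feval; rewrite /three_b /= ?t420 ?x42 ?y6.
all: by field.
Qed.

Lemma det_gram_neq0 b4 b5 : lam 3 7 != 0 ->
  \det (gram e (wform 1 (three_b b4 b5 (2 * lam 5 11 / 11)))) != 0.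
Proof.
move=> x_neq0; set w := wform _ _.
have wN := alternatingN (@wform_alternating 1 (three_b b4 b5 (2 * lam 5 11 / 11))).
have env0 a s : ~~ no_a6 (a, s) ->
    env 1 (three_b b4 b5 (2 * lam 5 11 / 11)) a s = 0.
  by rewrite /no_a6 negbK => /andP[/eqP /= -> /eqP /= ->].
apply: det_gram => [i j i12 j12 ij|i i12].
  rewrite wform_E // /wmat ifF; [|lia]; rewrite ifF; [|lia].
  by rewrite -(feval_restr _ env0) entry_no_a6 ?/feval ?big_nil //; lia.
have low a : (1 <= a <= 6)%N -> w (E a) (E (13 - a)) != 0.
  move=> a6; rewrite wform_E; [|lia..]; rewrite /wmat.
  case: ifP => [/eqP ->|a1]; first by rewrite oner_eq0.
  by rewrite ifF; [apply: antidiagonal_neq0; lia|lia].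
have [i6|i6] := leqP i 6; first by rewrite wN oppr_eq0 low //; lia.
by have := low (13 - i)%N; rewrite subKn; [apply|]; lia.
Qed.

(* The indeterminates that are kept are those which may be nonzero when
   alpha_(3,7) = alpha_(6,12) = 0. *)
Definition high_keep : pred (nat * nat) :=
  fun v => v \notin [:: (6, 12); (3, 7); (4, 9); (5, 11); (0, 6)]%N.

Lemma entry_high i j : (10 <= i <= 12)%N -> (3 <= j <= 12)%N ->
  frestr high_keep (entry i j) = [::].
Proof.
have /allP check : all (fun i => all (fun j =>
    frestr high_keep (entry i j) == [::]) (iota 3 10)) (iota 10 3).
  by vm_compute.
move=> i12 j12; have /check/allP/(_ j) : i \in iota 10 3 by rewrite mem_iota; lia.
by rewrite mem_iota => /(_ _)/eqP; apply; lia.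
Qed.

(** Here i + j >= 13, so every monomial contains b_6, alpha_(6,12) or a weight-zero constant. The
    latter is not alpha_(2,5), which needs e_2, so all of them vanish. *)
Lemma cocycle_corner (v : Defs.form g) i j : lam 3 7 = 0 -> Z2 br v ->
  (10 <= i <= 12)%N -> (3 <= j <= 12)%N -> v (E i) (E j) = 0.
Proof.
move=> x0 vZ2 i12 j12; have vN := alternatingN (proj1 vZ2).
have corner a b : (10 <= a <= 12)%N -> (3 <= b < a)%N -> v (E a) (E b) = 0.
  move=> a12 b12; have [v' [v'Z2 v'1] ->] := form_high vZ2; [|rewrite ?a6_12 ?eqxx; lia..].
  rewrite (entryE v'Z2 v'1); [|lia..]; rewrite -(@feval_restr _ _ high_keep).
    by rewrite entry_high ?/feval ?big_nil //; lia.
  move=> c s; rewrite /high_keep negbK !inE.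
  have [[_ y0 z0]|[z0 _ x42 _]] := weight_zero_law a6_12; last first.
    by move: x42 => /eqP; rewrite x0 eq_sym mulf_eq0 (negPf z0) (negPf (numeral_neq0 char0 _)).
  do ![case/predU1P => [[-> ->] //|]]; move=> /eqP[-> ->] /=.
  by apply: b6_subdiagonal => //; right.
have [ij|ji|->] := ltngtP i j; last exact: (proj1 vZ2).
  by rewrite vN corner ?oppr0 //; lia.
by apply: corner; lia.
Qed.

Lemma not_symplectic_subdiagonal : lam 3 7 = 0 -> ~ symplectic br.
Proof.
move=> x0 [v vZ2 v_nondeg].
(* e_10, e_11, e_12 pair only with e_1 and e_2; a left kernel vector of this 3 by 2 matrix gives an
   element of the radical. *)
pose A : 'M[k]_(3, 2) := \matrix_(i, j) v (E (10 + i)) (E (1 + j)).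
have : kermx A != 0 by rewrite kermx_eq0 /row_free; have := rank_leq_col A; lia.
case/rowV0Pn => a /sub_kermxP aA a_neq0.
pose c r := if (r < 10)%N then 0 else a 0 (inord (r - 10)).
have cE (i : 'I_3) : c (10 + i)%N = a 0 i by rewrite /c addKn inord_val.
pose x := \sum_(r <- iota 2 11) c r *: E r.
have xE : x = \sum_(i < 3) a 0 i *: E (10 + i).
  rewrite /x (_ : iota 2 11 = iota 2 8 ++ [seq (10 + i)%N | i <- iota 0 3]) //.
  rewrite big_cat /= big1_seq ?add0r; last first.
    move=> r /=; rewrite mem_iota => r10.
    by rewrite /c (_ : (r < 10)%N) ?scale0r //; lia.
  by rewrite !big_cons big_nil !big_ord_recl big_ord0 -!cE.
have x_eq0 : x = 0.
  apply: v_nondeg; elim/basis_ind => [b y y' IH IH'|j j12].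
    by rewrite linearP /= IH IH' scaler0 addr0.
  rewrite xE linear_sum sum_lfunE; under eq_bigr do rewrite linearZ scale_lfunE.
  have [j3|j2] := leqP 3 j.
    by apply: big1 => i _; rewrite cocycle_corner ?scaler0 //; have := ltn_ord i; lia.
  have j1 : (j.-1 < 2)%N by lia.
  have := congr1 (fun u : 'rV[k]_2 => u 0 (Ordinal j1)) aA; rewrite !mxE => {2}<-.
  apply: eq_bigr => i _; rewrite !mxE /= -[_ *: _]/(_ * _); congr (_ * v _ (E _)).
  lia.
case/eqP: a_neq0; apply/rowP => i; rewrite mxE.
rewrite -cE; apply: E_coef_eq0 x_eq0 _ _.
have := ltn_ord i; lia.
Qed.

End SubdiagonalCohomology.

End AdaptedBasis.

(** * The model algebra on k^12 and the three cases *)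

Lemma std_basisP (k : fieldType) : basis_of fullv (std_basis k 12).
Proof.
rewrite basisEdim; apply/andP; split; last by rewrite size_tuple dimvf dim_matrix.
apply/subvP => v _.
rewrite (row_sum_delta v); apply: memv_suml => i _; rewrite memvZ // memv_span //.
by apply/mapP; exists i; rewrite ?mem_enum.
Qed.

Lemma law_bracket_adapted (k : fieldType) (alpha : nat -> nat -> k) :
  adapted_basis (law_bracket 12 alpha) (std_basis k 12) alpha.
Proof.
split=> [|i j ij]; first exact: std_basisP.
by rewrite bilinE ?ij //; apply: basis_free (std_basisP k).
Qed.

Theorem proposition4p3 (k : fieldType) (char0 : [pchar k] =i pred0)
    (g : vectType k) (br : 'Hom(g, 'Hom(g, g))) (g_filiform : filiform br 12)
    (e : 12.-tuple g) (lambda : nat -> nat -> k) (lambda_law : laws 12 lambda)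
    (e_adapted : adapted_basis br e lambda) :
  (laws1 12 lambda ->
     (exists2 w, Z2 br w & H2 br = cls_span br [:: omega e 1; omega e 2; w])
     /\ ~ symplectic br)
  /\
  (laws2 12 lambda ->
     (exists beta, [/\ Z2 br beta, \det (gram e beta) != 0
        & H2 br = cls_span br [:: omega e 1; omega e 2; beta]])
     /\ symplectic br)
  /\
  (laws3 12 lambda ->
     H2 br = cls_span br [:: omega e 1; omega e 2] /\ ~ symplectic br).
Proof.
have [br_lie _ _ _] := g_filiform; have [lam0 law_lie] := lambda_law.
(* Membership in [laws1], [laws2], [laws3] is stated for the model bracket, so (a), (b), (c) are
   translated there and the conditions on [lambda] carried over to [br]. *)
have std := law_bracket_adapted lambda.
have A := propA_law law_lie lam0 std.
have B := propB_law law_lie lam0 std.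
have C := propC_law law_lie lam0 std.
split; [|split].
- move=> [_ /A a25 /B a6 /C x0].
  have [b4 [b5 [b6 [wZ2 _]]]] := cocycle_exists br_lie lam0 e_adapted char0 a25 a6.
  split; last exact: (not_symplectic_subdiagonal br_lie lam0 e_adapted char0 a25 a6 x0).
  by eexists; [exact: wZ2|apply: (H2_subdiagonal br_lie lam0 e_adapted)].
- move=> [_ /A a25 /B a6 /C /eqP x_neq0].
  have [b4 [b5 [b6 [wZ2 b6E]]]] := cocycle_exists br_lie lam0 e_adapted char0 a25 a6.
  have det_w : \det (gram e (wform e lambda 1 (three_b b4 b5 b6))) != 0.
    by rewrite b6E //; apply: (det_gram_neq0 br_lie lam0 e_adapted).
  split; last by eexists; [exact: wZ2|apply: (nondegenerate_gram e_adapted det_w)].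
  eexists; split; [exact: wZ2|exact: det_w|].
  exact: (H2_subdiagonal br_lie lam0 e_adapted).
- move=> [_ /A a25 nB].
  have a6 : lambda 6 12 != 0 by apply/eqP => /B.
  split; first exact: (H2_superdiagonal br_lie lam0 e_adapted).
  exact: (not_symplectic_superdiagonal br_lie lam0 e_adapted char0 a25 a6).
Qed.
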